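(* Let $n\ge 2$ and let $F:\mathbb{C}[x_1,\ldots,x_n]\to\mathbb{C}[x_1,\ldots,x_n]$ be a $\mathbb{C}$-algebra endomorphism that has an invertible Jacobian; write $F_i=F(x_i)$, and let $d_i$ denote the degree of the minimal polynomial of $x_i$ over $\mathbb{C}(F_1,\ldots,F_n)$, $1\le i\le n$. If $\gcd(d_u,d_v)=1$ for all $1\le u\ne v\le n$ (i.e. for each of the $\binom{n}{2}$ pairs of degrees), then $F$ is an automorphism.
   Context: $F$ has an invertible Jacobian means $\operatorname{Jac}(F_1,\ldots,F_n)=\det(\partial F_i/\partial x_j)\in\mathbb{C}^*$. The field $\mathbb{C}(F_1,\ldots,F_n)$ is regarded as a subfield of $\mathbb{C}(x_1,\ldots,x_n)$. *)

(* Defs.v *)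
From HB Require Import structures.
From mathcomp Require Import all_boot all_order all_algebra.
From mathcomp Require Import boolp classical_sets reals.
From mathcomp Require Import complex.
From mathcomp Require Import mpoly.

Set Implicit Arguments.
Unset Strict Implicit.
Unset Printing Implicit Defensive.

Import GRing.Theory.

Local Open Scope ring_scope.

Section Subfields.
Variable L : fieldType.

(* In a field, [divring_closed] (contains 1, closed under x - y and x / y)
   says exactly "is a subfield"; note that x / 0 = 0. *)
Definition subfield_gen (A : set L) : set L :=
  smallest (fun S : set L => GRing.divring_closed (mem S)) A.

Definition is_minpoly_over (K : set L) (x : L) (p : {poly L}) : Prop :=
  [/\ p \is monic, p \is a polyOver (mem K), root p x &
      forall q : {poly L},
        q != 0 -> q \is a polyOver (mem K) -> root q x -> (size p <= size q)%N].

(* For a subfield K there is at most one minimal polynomial; when x is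
   transcendental over K there is none, and the value is 0. *)
Definition minpoly_over (K : set L) (x : L) : {poly L} :=
  xget 0 [set p | is_minpoly_over K x p].

Definition minpoly_degree (K : set L) (x : L) : nat :=
  (size (minpoly_over K x)).-1.

End Subfields.

Section PolynomialEndomorphisms.
Variables (R : realType) (n : nat).
Local Notation P := {mpoly R[i][n]}.

Definition jacobian (F : P -> P) : P :=
  \det (\matrix_(i < n, j < n) (F 'X_i)^`M(j)).

Definition invertible_jacobian (F : P -> P) : Prop :=
  exists2 c : R[i], c != 0 & jacobian F = c%:MP.

(* The subfield C(F_1, ..., F_n) of C(x_1, ..., x_n). *)
Definition image_field (F : P -> P) : set {fraction P} :=
  subfield_gen (range (fun c : R[i] => tofrac (c%:MP : P))
                `|` range (fun i : 'I_n => tofrac (F 'X_i)))%classic.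

Definition var_degree (F : P -> P) (i : 'I_n) : nat :=
  minpoly_degree (image_field F) (tofrac ('X_i : P)).

End PolynomialEndomorphisms.

(* Main.v *)
Require Import Defs.
From HB Require Import structures.
From mathcomp Require Import all_boot all_order all_algebra.
From mathcomp Require Import boolp classical_sets reals.
From mathcomp Require Import complex.
From mathcomp Require Import mpoly.
From mathcomp Require Import ring.

(* Let K = C(F_1, ..., F_n), L = C(x_1, ..., x_n), and E the field generated
   over K by the x_l with l <> i.  Pairwise coprimality of the degrees gives
   that x_i has degree d_i over E.  Write d/dF_k for the derivations of L dual to
   the F_k; they preserve K, so d x_l / d F_k lies in K(x_l), inside E for
   l <> i.  By Cramer's rule and since the Jacobian is constant, d F_j / d x_i is
   a minor not involving x_i, so it lies in E, and d/dx_i maps K into E.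
   Differentiating the minimal polynomial p of x_i along d/dx_i yields a relation
   for x_i over E of degree less than d_i; it is trivial, and its top
   coefficient says that d/dx_i kills x_i + p_(d_i - 1) / d_i.  The kernel of
   d/dx_i is the field of fractions in the other variables, so x_i is in E and
   d_i = 1.  Hence F is birational, and a birational Keller map is an
   automorphism. *)

Set Implicit Arguments.
Unset Strict Implicit.
Unset Printing Implicit Defensive.

Import GRing.Theory Num.Theory.

Local Open Scope ring_scope.

(** * Linear algebra over a subfield *)

Section SubfieldLinearAlgebra.
Variable L : fieldType.
Implicit Types (K E : divringClosed L).

(** The constancy of the Jacobian determinant is used in several ways: it makes the derivations
    d/dF_k map polynomials to polynomials, it makes F injective, so that the elements of K are
    quotients F(u)/F(v), and it allows Cramer's rule without new denominators. The element x_i +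
    p_(d_i - 1) / d_i is x_i minus the mean of its conjugates over K. The correction lies in K, so
    x_i itself is in E as soon as this element is; then 1 and x_i are dependent over E, which
    freeness of the powers below d_i allows only for d_i = 1. The obstacle in the birational case is
    that F(u) and F(v) may share a prime factor although u and v do not: a prime ideal of height one
    could contract along F to one of larger height. A bound on the rank of the gradients excludes
    this, and unique factorization then yields a common factor of u and v. Degrees of extensions are
    counted with spanning and free families over subfields of L. *)

Definition spans K (I : finType) (b : I -> L) (y : L) : Prop :=
  exists2 c : I -> L, forall i, c i \in K & y = \sum_i c i * b i.

Definition free_over K (I : finType) (b : I -> L) : Prop :=
  forall c : I -> L, (forall i, c i \in K) -> \sum_i c i * b i = 0 ->
  forall i, c i = 0.

Lemma not_free_over K (I : finType) (b : I -> L) : ~ free_over K b ->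
  exists c : I -> L, [/\ forall i, c i \in K, \sum_i c i * b i = 0 &
    exists i, c i != 0].
Proof.
move=> nfr; apply: contrapT => H; apply: nfr => c cK c0 i.
apply: contrapT => ci; apply: H; exists c; split=> //.
by exists i; exact/eqP.
Qed.

(** Gaussian elimination on m equations in n > m unknowns: either the first equation is vacuous, or
    a pivot removes one equation and one unknown. Closure of K under division keeps the solution in
    K. *)
Lemma kernel_over K m n (A : 'I_n -> 'I_m -> L) :
  (forall i j, A i j \in K) -> (m < n)%N ->
  exists u : 'I_n -> L, [/\ forall i, u i \in K, exists i, u i != 0 &
    forall j, \sum_i u i * A i j = 0].
Proof.
elim: m n A => [|m IH] [//|n] A AK lmn.
  exists (fun=> 1); split=> [i||[]//]; first exact: rpred1.
  by exists ord0; exact: oner_neq0.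
have [A0|] := boolP [forall i, A i ord0 == 0].
  have [||u [uK u0 uA]] := IH n.+1 (fun i j => A i (lift ord0 j)).
  - by move=> i j; exact: AK.
  - exact: ltnW.
  exists u; split=> // j; case: (unliftP ord0 j) => [k ->|->]; first exact: uA.
  by apply: big1 => i _; rewrite (eqP (forallP A0 i)) mulr0.
rewrite negb_forall => /existsP[i0 Ai0].
have [||v [vK [k0 vk0] vA]] := IH n (fun k j => A (lift i0 k) (lift ord0 j)
    - A (lift i0 k) ord0 / A i0 ord0 * A i0 (lift ord0 j)).
- by move=> k j; rewrite rpredB ?rpredM ?rpredV ?AK.
- by [].
(* The value that the first equation forces on the pivot unknown [i0]. *)
pose w := - \sum_k v k * (A (lift i0 k) ord0 / A i0 ord0).
exists (fun i => if unlift i0 i is Some k then v k else w).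
have sumE j : \sum_i (if unlift i0 i is Some k then v k else w) * A i j
    = w * A i0 j + \sum_k v k * A (lift i0 k) j.
  rewrite (bigD1_ord i0) //= unlift_none; congr (_ + _).
  by apply: eq_bigr => k _; rewrite liftK.
split.
- move=> i; case: unlift => [k|]; first exact: vK.
  by rewrite rpredN rpred_sum // => k _; rewrite !rpredM ?rpredV ?AK.
- by exists (lift i0 k0); rewrite liftK.
move=> j; rewrite sumE; case: (unliftP ord0 j) => [k ->|->].
  rewrite -[RHS](vA k) mulNr mulr_suml addrC -sumrB; apply: eq_bigr => l _.
  by rewrite mulrBr !mulrA.
rewrite mulNr mulr_suml addrC -sumrB big1 // => l _.
by rewrite -!mulrA mulVf // mulr1 subrr.
Qed.

(** Steinitz by counting: once each [a j] is written in terms of b, a relation among the [a j] is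
    found by solving #|I| equations in #|J| unknowns. *)
Lemma dependent_of_card K (I J : finType) (b : I -> L) (a : J -> L) :
  (forall j, spans K b (a j)) -> (#|I| < #|J|)%N -> ~ free_over K a.
Proof.
move=> sp ltIJ fr.
have /choice[c cP] : forall j, exists c : I -> L,
    (forall i, c i \in K) /\ a j = \sum_i c i * b i.
  by move=> j; have [c cK ->] := sp j; exists c.
have [|u [uK [i0 ui0] uA]] :=
  @kernel_over K _ _ (fun j i => c (enum_val j) (enum_val i)) _ ltIJ.
  by move=> i j; exact: (cP _).1.
suff : u i0 = 0 by move/eqP; rewrite (negPf ui0).
have := fr (fun j => u (enum_rank j)) _ _ (enum_val i0).
rewrite enum_valK; apply=> [j|]; first exact: uK.
rewrite (reindex (@enum_val J J)) /=; last exact/onW_bij/enum_val_bij.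
under eq_bigr => j _ do rewrite enum_valK (cP _).2 mulr_sumr.
rewrite exchange_big /= big1 // => i _.
under eq_bigr => j _ do rewrite mulrA.
rewrite -mulr_suml.
have := uA (enum_rank i); under eq_bigr => j _ do rewrite enum_rankK.
by move=> ->; rewrite mul0r.
Qed.

Lemma spans_subset K E (I : finType) (b : I -> L) y :
  {subset K <= E} -> spans K b y -> spans E b y.
Proof. by move=> KE [c cK ->]; exists c => // i; exact: KE. Qed.

Lemma spans_gen K (I : finType) (b : I -> L) i : spans K b (b i).
Proof.
exists (fun j => (j == i)%:R) => [j|]; first exact: rpred_nat.
by rewrite (bigD1 i) //= eqxx mul1r big1 ?addr0 // => j /negPf->; rewrite mul0r.
Qed.

Lemma spans0 K (I : finType) (b : I -> L) : spans K b 0.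
Proof.
exists (fun=> 0) => [i|]; first exact: rpred0.
by rewrite big1 // => i _; rewrite mul0r.
Qed.

Lemma spansD K (I : finType) (b : I -> L) y z :
  spans K b y -> spans K b z -> spans K b (y + z).
Proof.
move=> [c cK ->] [d dK ->]; exists (fun i => c i + d i) => [i|].
  exact: rpredD.
by rewrite -big_split; apply: eq_bigr => i _; rewrite mulrDl.
Qed.

Lemma spansZ K (I : finType) (b : I -> L) k y :
  k \in K -> spans K b y -> spans K b (k * y).
Proof.
move=> kK [c cK ->]; exists (fun i => k * c i) => [i|]; first exact: rpredM.
by rewrite mulr_sumr; apply: eq_bigr => i _; rewrite mulrA.
Qed.

Lemma spans_sum K (I J : finType) (b : I -> L) (y : J -> L) :
  (forall j, spans K b (y j)) -> spans K b (\sum_j y j).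
Proof.
by move=> yb; elim/big_ind: _ => //; [exact: spans0 | exact: spansD].
Qed.

Lemma spans_trans K (I J : finType) (b : I -> L) (a : J -> L) y :
  (forall j, spans K b (a j)) -> spans K a y -> spans K b y.
Proof. by move=> ab [c cK ->]; apply: spans_sum => j; exact: spansZ. Qed.

Definition has_dim K (V : L -> Prop) (m : nat) : Prop :=
  exists b : 'I_m -> L, [/\ forall i, V (b i), forall y, V y -> spans K b y &
    free_over K b].

Lemma spans_ordinal K (I : finType) (b : I -> L) y :
  spans K b y -> spans K (fun k : 'I_#|I| => b (enum_val k)) y.
Proof.
apply: spans_trans => i; rewrite -[in b i](enum_rankK i).
exact: (@spans_gen K _ (fun k : 'I_#|I| => b (enum_val k))).
Qed.

Lemma dependent_drop K m (b : 'I_m -> L) : ~ free_over K b ->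
  exists i : 'I_m, forall y, spans K b y ->
    spans K (fun k : 'I_m.-1 => b (lift i k)) y.
Proof.
move=> /not_free_over[c [cK c0 [i ci]]]; exists i => y; apply: spans_trans => j.
case: (unliftP i j) => [k ->|->]; first exact: (spans_gen K (fun k => b (lift i k))).
move: c0; rewrite (bigD1_ord i) //= => /eqP; rewrite addr_eq0 => /eqP c0.
have -> : b i = \sum_k (- (c (lift i k) / c i)) * b (lift i k).
  apply: (mulfI ci); rewrite c0 mulr_sumr -sumrN; apply: eq_bigr => k _.
  by rewrite mulNr mulrN mulrA [c i * _]mulrC divfK.
exists (fun k => - (c (lift i k) / c i)) => // k.
by rewrite rpredN rpredM ?rpredV.
Qed.

(** A spanning family of least size is free, since a dependent one can drop a member. *)
Lemma finite_dim K (V : L -> Prop) (I : finType) (b : I -> L) :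
  (forall i, V (b i)) -> (forall y, V y -> spans K b y) ->
  exists2 m, has_dim K V m & (m <= #|I|)%N.
Proof.
move=> bV bs.
pose P m := `[< exists a : 'I_m -> L,
  (forall i, V (a i)) /\ forall y, V y -> spans K a y >].
have P0 : P #|I|.
  apply/asboolP; exists (fun k => b (enum_val k)); split=> // y /bs.
  exact: spans_ordinal.
have [m /asboolP[a [aV as_]] mmin] := ex_minnP (ex_intro P _ P0).
exists m; last exact: mmin.
exists a; split=> //; apply: contrapT => /dependent_drop[i di].
have : (m <= m.-1)%N.
  apply: mmin; apply/asboolP; exists (fun k => a (lift i k)); split=> // y Vy.
  exact/di/as_.
by case: m i {P0 mmin a aV as_ di} => [[]//|m _]; rewrite ltnn.
Qed.

Lemma free_card_le_dim K (V : L -> Prop) m (I : finType) (b : I -> L) :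
  has_dim K V m -> (forall i, V (b i)) -> free_over K b -> (#|I| <= m)%N.
Proof.
move=> [a [aV sa _]] bV fb; rewrite leqNgt; apply/negP => lt.
by apply: (@dependent_of_card K _ _ a b) fb => [j|]; [exact/sa | rewrite card_ord].
Qed.

Lemma dim_le_span_card K (V : L -> Prop) m (I : finType) (b : I -> L) :
  has_dim K V m -> (forall y, V y -> spans K b y) -> (m <= #|I|)%N.
Proof.
move=> [a [aV _ fa]] sb; rewrite leqNgt; apply/negP => lt.
by apply: (@dependent_of_card K _ _ b a) fa => [j|]; [exact/sb | rewrite card_ord].
Qed.

Lemma span_card_dim_free K (V : L -> Prop) (I : finType) (b : I -> L) :
  has_dim K V #|I| -> (forall i, V (b i)) -> (forall y, V y -> spans K b y) ->
  free_over K b.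
Proof.
move=> dV bV sb; apply: contrapT => nfr.
have : ~ free_over K (fun k : 'I_#|I| => b (enum_val k)).
  move=> fr; apply: nfr => c cK c0 i; rewrite -(enum_rankK i).
  apply: (fr (fun k => c (enum_val k))) => //.
  by rewrite -[RHS]c0 [RHS](reindex (@enum_val I I)) //; exact/onW_bij/enum_val_bij.
move=> /dependent_drop[i di].
have := dim_le_span_card dV (fun y Vy => di y (spans_ordinal (sb y Vy))).
rewrite card_ord; case: (#|I|) i {dV di} => [[]//|m _]; by rewrite ltnn.
Qed.

(** * Towers of subfields and products of bases *)

Section Tower.
Variables (K E : divringClosed L) (KE : {subset K <= E}).
Variables (I J : finType) (b : J -> L) (c : I -> L).
Let prod_fam (p : J * I) := b p.1 * c p.2.

Lemma spans_tower y : (forall z, z \in E -> spans K b z) -> spans E c y ->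
  spans K prod_fam y.
Proof.
move=> sb [e eE ->]; apply: spans_sum => i.
have [k kK ->] := sb _ (eE i); rewrite mulr_suml; apply: spans_sum => j.
rewrite -mulrA; apply: spansZ => //; exact: (spans_gen K prod_fam (j, i)).
Qed.

Lemma free_tower : (forall j, b j \in E) -> free_over K b -> free_over E c ->
  free_over K prod_fam.
Proof.
move=> bE fb fc k kK k0 [j i].
apply: (fb (fun j => k (j, i))) => // {j}.
apply: (fc (fun i => \sum_j k (j, i) * b j)) => [{}i|].
  by rewrite rpred_sum // => j _; rewrite rpredM ?bE ?KE.
rewrite -[RHS]k0; under eq_bigr => ? _ do rewrite mulr_suml.
rewrite exchange_big /= pair_big; apply: eq_bigr => -[j l] _.
by rewrite mulrA.
Qed.

(** As b spans E over K, an E-relation among the c expands into a K-relation among the products. In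
    the application c consists of the powers of x_i, and this is how its degree over E is read
    off. *)
Lemma free_tower_top : (forall z, z \in E -> spans K b z) ->
  free_over K prod_fam -> free_over E c.
Proof.
move=> sb fr e eE e0.
have /choice[k kP] : forall i, exists k : J -> L,
    (forall j, k j \in K) /\ e i = \sum_j k j * b j.
  by move=> i; have [k kK ->] := sb _ (eE i); exists k.
move=> i; rewrite (kP i).2 big1 // => j _.
suff -> : k i j = 0 by rewrite mul0r.
apply: (fr (fun p => k p.2 p.1) _ _ (j, i)) => [p|]; first exact: (kP _).1.
rewrite -[RHS]e0 -(pair_big xpredT xpredT (fun j i => k i j * (b j * c i))) /=.
rewrite exchange_big /=; apply: eq_bigr => l _.
by rewrite (kP l).2 mulr_suml; apply: eq_bigr => ? _; rewrite mulrA.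
Qed.

End Tower.

Definition powers (x : L) (d : nat) (k : 'I_d) : L := x ^+ k.

(** Meant for a d with [x ^+ d] in the span of the lower powers; under that condition it is the
    field K(x). *)
Definition adjoin K (x : L) (d : nat) : {pred L} :=
  fun y => `[< spans K (@powers x d) y >].

Section Adjoin.
Variables (K : divringClosed L) (x : L) (d : nat).
Hypothesis xd : spans K (@powers x d) (x ^+ d).

Lemma adjoinP y : reflect (spans K (@powers x d) y) (y \in adjoin K x d).
Proof. exact: asboolP. Qed.

Let spans_mulx y : spans K (@powers x d) y -> spans K (@powers x d) (x * y).
Proof.
move=> [c cK ->]; rewrite mulr_sumr; apply: spans_sum => k.
rewrite mulrCA; apply: spansZ => //; rewrite /powers -exprS.
have [lt|ge] := ltnP k.+1 d.
  exact: (spans_gen K (@powers x d) (Ordinal lt)).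
by have -> : k.+1 = d by apply/eqP; rewrite eqn_leq ltn_ord.
Qed.

Let spans_pow k : spans K (@powers x d) (x ^+ k).
Proof.
elim: k => [|k IH]; last by rewrite exprS; exact: spans_mulx.
(* For d = 0 the hypothesis [xd] is itself the claim that 1 is in the span. *)
have [d0|d0] := posnP d; first by move: xd; rewrite [in x ^+ _]d0.
exact: (spans_gen K (@powers x d) (Ordinal d0)).
Qed.

Let spansM y z : spans K (@powers x d) y -> spans K (@powers x d) z ->
  spans K (@powers x d) (y * z).
Proof.
move=> [c cK ->] zs; rewrite mulr_suml; apply: spans_sum => k.
rewrite -mulrA; apply: spansZ => //; rewrite /powers.
by elim: (k : nat) => [|m IH]; rewrite ?mul1r // exprS -mulrA; exact: spans_mulx.
Qed.

(* A finite-dimensional domain is a field: for y <> 0 the m + 1 elements 1 and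
   y * b_i of the span of the basis b are dependent over K. *)
Let spansV y : spans K (@powers x d) y -> spans K (@powers x d) y^-1.
Proof.
move=> ys; have [->|y0] := eqVneq y 0; first by rewrite invr0; exact: spans0.
have [m [b [bV sb fb]] _] := @finite_dim K (spans K (@powers x d)) _ _
  (spans_gen K (@powers x d)) (fun y ys => ys).
pose a (o : option 'I_m) := if o is Some i then y * b i else 1.
have : ~ free_over K a.
  apply: (@dependent_of_card K _ _ b); last by rewrite card_option card_ord.
  by case=> [i|]; apply: sb; [exact: spansM | exact: (spans_pow 0)].
move=> /not_free_over[c [cK c0 [i ci]]].
have ac : \sum_o c o * a o = c None + y * \sum_i c (Some i) * b i.
  rewrite (bigD1 None) //= mulr1 mulr_sumr; congr (_ + _).
  rewrite (reindex_omap Some id) /=; last by case.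
  by apply: eq_big => [k|k _]; rewrite ?eqxx // mulrCA.
have cN : c None != 0.
  apply/eqP => cN; move: c0; rewrite ac cN add0r => /eqP.
  rewrite mulf_eq0 (negPf y0) /= => /eqP /(fb (fun i => c (Some i))).
  move=> cS; case: i ci => [i|]; last by rewrite cN eqxx.
  by rewrite cS ?eqxx.
have -> : y^-1 = - (c None)^-1 * \sum_i c (Some i) * b i.
  apply: (mulfI y0); rewrite mulfV // mulrCA; apply: (mulfI cN).
  rewrite mulr1 [RHS]mulrA mulrN mulfV // mulN1r; apply/eqP.
  by rewrite -addr_eq0 -ac c0.
apply: spansZ; first by rewrite rpredN rpredV.
by apply: spans_sum => k; apply: spansZ.
Qed.

Lemma adjoin_divring_closed : GRing.divring_closed (adjoin K x d).
Proof.
split.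
- exact/adjoinP/(spans_pow 0).
- move=> y z /adjoinP ys /adjoinP zs; apply/adjoinP; apply: spansD => //.
  by rewrite -mulN1r; apply: spansZ => //; rewrite rpredN rpred1.
- by move=> y z /adjoinP ys /adjoinP zs; apply/adjoinP/spansM => //; exact: spansV.
Qed.

Lemma adjoin_subset : {subset K <= adjoin K x d}.
Proof.
move=> k kK; apply/adjoinP; rewrite -[k]mulr1.
exact: (spansZ kK (spans_pow 0)).
Qed.

Lemma adjoin_gen : x \in adjoin K x d.
Proof. exact/adjoinP/(spans_pow 1). Qed.

End Adjoin.

Lemma divringClosed_of (S : {pred L}) : GRing.divring_closed S ->
  exists E : divringClosed L, E =i S.
Proof.
move=> hS.
pose m := GRing.isDivringClosed.Build L S hS.
pose E : divringClosed L := HB.pack S m.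
by exists E.
Qed.


Lemma adjoin_field K x d : spans K (@powers x d) (x ^+ d) ->
  exists E : divringClosed L, [/\ {subset K <= E}, x \in E &
    forall y, y \in E <-> spans K (@powers x d) y].
Proof.
move=> xd; have [E EE] := divringClosed_of (adjoin_divring_closed xd).
exists E; split=> [k kK||y]; rewrite EE; first exact: adjoin_subset.
  exact: adjoin_gen.
by split=> /adjoinP.
Qed.

(** Multiplicativity of degrees in the tower from K through K(x) to Q. *)
Lemma dvd_dim K (Q : divringClosed L) x d D : {subset K <= Q} -> x \in Q ->
  spans K (@powers x d) (x ^+ d) -> free_over K (@powers x d) ->
  has_dim K (fun y => y \in Q) D -> (d %| D)%N.
Proof.
move=> KQ xQ xd fx dQ; have [b [bQ sb _]] := dQ.
have [E [KE xE EE]] := adjoin_field xd.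
have [m [e [eQ se fe]] _] :
    exists2 m, has_dim E (fun y => y \in Q) m & (m <= #|'I_D|)%N.
  by apply: (@finite_dim E (fun y => y \in Q) _ b) => // y /sb; exact: spans_subset.
suff -> : D = (d * m)%N by exact: dvdn_mulr.
have pE (k : 'I_d) : powers x k \in E by rewrite rpredX.
have pQ (k : 'I_d) : powers x k \in Q by rewrite rpredX.
have fb := free_tower KE pE fx fe.
have sp y : y \in Q -> spans K (fun p : 'I_d * 'I_m => powers x p.1 * e p.2) y.
  by move/se; apply: spans_tower => z /EE.
apply/eqP; rewrite eqn_leq.
have := dim_le_span_card dQ sp; have := free_card_le_dim dQ _ fb.
rewrite card_prod !card_ord => le1 le2; rewrite le2 le1 // => -[k l] /=.
by rewrite rpredM.
Qed.

Lemma coprime_prod_dvdn (I : eqType) (s : seq I) (d : I -> nat) m : uniq s ->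
  (forall i j, i != j -> coprime (d i) (d j)) ->
  (forall i, d i %| m)%N -> (\prod_(i <- s) d i %| m)%N.
Proof.
move=> us cop dm; elim: s us => [|i s IH] /=; first by rewrite big_nil dvd1n.
move=> /andP[is_ us]; rewrite big_cons Gauss_dvd ?dm ?IH //.
elim: s is_ {us IH} => [|j s IH]; first by rewrite big_nil coprimen1.
rewrite inE negb_or big_cons coprimeMr => /andP[ij is_].
by rewrite cop // IH.
Qed.

(* A divisibility count: each d_j divides the degree over K of the field
   generated by all the x_j, hence so does their product, while the monomials
   in the x_j with exponents less than d_j span that field. So these monomials
   form a basis. *)
Lemma coprime_adjoin K (I : finType) (x : I -> L) (d : I -> nat) :
  (forall i, spans K (@powers (x i) (d i)) (x i ^+ d i)) ->
  (forall i, free_over K (@powers (x i) (d i))) ->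
  (forall i j, i != j -> coprime (d i) (d j)) ->
  forall i, exists E : divringClosed L, [/\ {subset K <= E},
    forall j, j != i -> x j \in E & free_over E (@powers (x i) (d i))].
Proof.
move=> xd fx cop i.
(* The x_j are adjoined one at a time, so the monomials b span E by construction; nothing is claimed
   yet about their independence. *)
have tower (s : seq I) : exists E : divringClosed L, [/\ {subset K <= E},
    forall j, j \in s -> x j \in E &
    exists (J : finType) (b : J -> L), [/\ #|J| = \prod_(j <- s) d j,
      forall j, b j \in E & forall y, y \in E -> spans K b y]].
  elim: s => [|j s [E [KE xE [J [b [cJ bE sb]]]]]].
    exists K; split=> //; exists unit, (fun=> 1); split=> [|_|y yK].
    - by rewrite big_nil card_unit.
    - exact: rpred1.
    - by exists (fun=> y) => //; rewrite (bigD1 tt) //= big1 ?mulr1 ?addr0 // => -[].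
  have [F [EF xF FF]] := adjoin_field (spans_subset KE (xd j)).
  exists F; split.
  - by move=> k /KE /EF.
  - by move=> k; rewrite inE => /orP[/eqP-> //|/xE/EF].
  exists (J * 'I_(d j))%type, (fun p => b p.1 * powers (x j) p.2); split.
  - by rewrite card_prod card_ord cJ big_cons mulnC.
  - by move=> [k l]; rewrite rpredM ?rpredX // EF.
  - by move=> y /FF; exact: spans_tower.
pose s := [seq j <- enum I | j != i].
have [E [KE xE [J [b [cJ bE sb]]]]] := tower s.
have xdE := spans_subset KE (xd i).
have [F [EF xF FF]] := adjoin_field xdE.
have KF : {subset K <= F} by move=> k /KE/EF.
exists E; split=> // [j ji|].
  by apply: xE; rewrite mem_filter ji mem_enum.
pose e (p : J * 'I_(d i)) := b p.1 * powers (x i) p.2.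
have eF p : e p \in F by rewrite rpredM ?rpredX // EF.
have se y : y \in F -> spans K e y by move/FF; exact: spans_tower.
have [D dD leD] := @finite_dim K (fun y => y \in F) _ e eF se.
apply: (free_tower_top sb); apply: (@span_card_dim_free K (fun y => y \in F)) => //.
suff -> : #|{: J * 'I_(d i)}| = D by [].
(* Positivity turns the divisibility of D by the product of the degrees into an inequality. *)
have D0 : (0 < D)%N.
  case: D dD {leD} => // -[a [_ sa _]].
  by have [c _ /eqP] := sa 1 (rpred1 _); rewrite big_ord0 oner_eq0.
apply/eqP; rewrite eqn_leq leD andbT.
have -> : #|{: J * 'I_(d i)}| = (\prod_(j <- i :: s) d j)%N.
  by rewrite card_prod card_ord cJ big_cons mulnC.
apply: dvdn_leq => //.
apply: coprime_prod_dvdn => // [|j].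
  by rewrite /= filter_uniq ?enum_uniq // mem_filter eqxx.
apply: (dvd_dim KF _ (xd j) (fx j) dD).
by have [->//|ji] := eqVneq j i; rewrite EF // xE // mem_filter ji mem_enum.
Qed.

End SubfieldLinearAlgebra.

(** * Unique factorization in polynomial rings *)

Section Factorial.
Variable R : idomainType.
Implicit Types a b c p u : R.

Definition divides a b : Prop := exists c, b = a * c.

Definition prime_elt p : Prop := [/\ p != 0, p \isn't a GRing.unit &
  forall a b, divides p (a * b) -> divides p a \/ divides p b].

(** The factors are prime rather than irreducible, so uniqueness of the factorization is built
    in. *)
Definition has_factorization a : Prop := exists u (s : seq R),
  [/\ u \is a GRing.unit, forall p, p \in s -> prime_elt p &
      a = u * \prod_(p <- s) p].

Lemma divides_mull a b c : divides a b -> divides a (b * c).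
Proof. by move=> [d ->]; exists (d * c); rewrite mulrA. Qed.

Lemma divides_mulr a b c : divides a b -> divides a (c * b).
Proof. by rewrite mulrC; exact: divides_mull. Qed.

Lemma dividesD a b c : divides a b -> divides a c -> divides a (b + c).
Proof. by move=> [d ->] [e ->]; exists (d + e); rewrite mulrDr. Qed.

Lemma divides_trans a b c : divides a b -> divides b c -> divides a c.
Proof. by move=> [d ->] [e ->]; exists (d * e); rewrite mulrA. Qed.

Lemma divides_unitr a u : u \is a GRing.unit -> divides a u ->
  a \is a GRing.unit.
Proof. by move=> + [c cE]; rewrite cE unitrM => /andP[]. Qed.

Lemma has_factorization_unit u : u \is a GRing.unit -> has_factorization u.
Proof. by move=> uu; exists u, [::]; rewrite big_nil mulr1. Qed.

Lemma has_factorization_prime p : prime_elt p -> has_factorization p.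
Proof.
move=> pp; exists 1, [:: p]; rewrite unitr1 big_seq1 mul1r; split=> // q.
by rewrite inE => /eqP->.
Qed.

Lemma has_factorizationM a b :
  has_factorization a -> has_factorization b -> has_factorization (a * b).
Proof.
move=> [u [s [uu sp ->]]] [v [t [vu tp ->]]]; exists (u * v), (s ++ t).
rewrite unitrM uu vu big_cat mulrACA; split=> // p.
by rewrite mem_cat => /orP[/sp|/tp].
Qed.

Lemma prime_divisor a : has_factorization a -> a \isn't a GRing.unit ->
  exists2 p, prime_elt p & divides p a.
Proof.
move=> [u [[|p s] [uu sp ->]]]; first by rewrite big_nil mulr1 uu.
move=> _; exists p; first by apply: sp; rewrite mem_head.
by rewrite big_cons mulrCA; exists (u * \prod_(j <- s) j).
Qed.

Lemma prime_divides_prime p q : prime_elt p -> prime_elt q -> divides p q ->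
  divides q p.
Proof.
move=> [p0 pu _] [q0 qu qp] [c qE].
have [|//|[d cE]] := qp p c; first by exists 1; rewrite mulr1.
move: pu; suff -> : p \is a GRing.unit by [].
apply/unitrPr; exists d; apply: (mulfI q0).
by rewrite mulr1 mulrCA -cE.
Qed.

Lemma prime_divides_prod p u (s : seq R) : prime_elt p ->
  u \is a GRing.unit -> divides p (u * \prod_(q <- s) q) ->
  exists2 q, q \in s & divides p q.
Proof.
move=> [_ pu pp] uu; elim: s => [|q s IH].
  by rewrite big_nil mulr1 => /(divides_unitr uu); rewrite (negPf pu).
rewrite big_cons mulrCA => /pp[pq|/IH[r rs pr]].
  by exists q; rewrite ?mem_head.
by exists r; rewrite // inE rs orbT.
Qed.

(** The prime p is associate to some member of s, which is then deleted. The strict drop in length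
    is the measure for the extraction of contents. *)
Lemma factorization_div_prime p b u (s : seq R) : prime_elt p ->
  u \is a GRing.unit -> (forall q, q \in s -> prime_elt q) ->
  p * b = u * \prod_(q <- s) q ->
  exists v t, [/\ v \is a GRing.unit, forall q, q \in t -> prime_elt q,
    b = v * \prod_(q <- t) q & (size t < size s)%N].
Proof.
move=> pp uu sp E.
have [|q qs pq] := @prime_divides_prod p u s pp uu; first by exists b.
have [c pE] := prime_divides_prime pp (sp q qs) pq; have [d qE] := pq.
have [p0 _ _] := pp; have [q0 _ _] := sp q qs.
have du : d \is a GRing.unit.
  by apply/unitrPr; exists c; apply: (mulfI p0); rewrite mulrA -qE -pE mulr1.
exists (u * d), (rem q s); split.
- by rewrite unitrM uu.
- by move=> r /mem_rem /sp.
- apply: (mulfI p0); rewrite E (perm_big _ (perm_to_rem qs)) big_cons qE.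
  by rewrite !mulrA; congr (_ * _); rewrite -mulrA mulrC mulrAC.
- rewrite size_rem //; case: s qs {sp E} => //= *; exact: leqnn.
Qed.

End Factorial.

Lemma prime_elt_transport (R S : idomainType) (f : {rmorphism R -> S})
  (g : {rmorphism S -> R}) p : cancel f g -> cancel g f ->
  prime_elt p -> prime_elt (g p).
Proof.
move=> fK gK [p0 pu pp]; split.
- by rewrite -(rmorph0 g) (can_eq gK).
- by apply: contra pu => /(rmorph_unit f); rewrite gK.
move=> a b [c E]; have [|[d dE]|[d dE]] := pp (f a) (f b).
- by exists (f c); rewrite -rmorphM E rmorphM gK.
- by left; exists (g d); rewrite -rmorphM -dE fK.
- by right; exists (g d); rewrite -rmorphM -dE fK.
Qed.

Lemma has_factorization_transport (R S : idomainType) (f : {rmorphism R -> S})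
  (g : {rmorphism S -> R}) a : cancel f g -> cancel g f ->
  has_factorization (f a) -> has_factorization a.
Proof.
move=> fK gK [u [s [uu sp E]]]; exists (g u), (map g s); split.
- exact: rmorph_unit.
- by move=> _ /mapP[p ps ->]; apply: (prime_elt_transport fK gK); exact: sp.
- by rewrite -[a]fK E rmorphM rmorph_prod big_map.
Qed.

(** * Gauss's lemma and factorization in R[X] *)

Section GaussLemma.
Variable R : idomainType.
Implicit Types (f g h : {poly R}) (a b c p : R).

Lemma size_sub_lead_lt f : f != 0 ->
  (size (f - lead_coef f *: 'X^((size f).-1))%R < size f)%N.
Proof.
move=> f0; rewrite [X in (_ < X)%N]polySpred //= ltnS; apply/leq_sizeP => j.
rewrite coefB coefZ coefXn leq_eqVlt => /orP[/eqP<-|lt].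
  by rewrite eqxx mulr1 subrr.
rewrite (gtn_eqF lt) mulr0 subr0 nth_default //.
by rewrite (leq_trans _ lt) // -polySpred.
Qed.

Lemma divides_polyCP p f :
  divides p%:P f <-> forall i, divides p f`_i.
Proof.
split=> [[g ->] i|/choice[c cE]]; first by exists g`_i; rewrite coefCM.
exists (\poly_(i < size f) c i); apply/polyP => i.
rewrite coefCM coef_poly; case: ltnP => [_|ge]; first exact: cE.
by rewrite mulr0 nth_default.
Qed.

(** If p divides a product, it divides the product of the leading coefficients, hence one of them;
    that leading term can be discarded modulo p, and the total size decreases. *)
Lemma prime_polyC p : prime_elt p -> prime_elt p%:P.
Proof.
move=> [p0 pu pp]; split; first by rewrite polyC_eq0.
  by rewrite poly_unitE coefC negb_and pu orbT.
have lead_div f : f != 0 -> divides p (lead_coef f) ->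
    exists2 g : {poly R}, (size g < size f)%N & divides p%:P (f - g).
  move=> f0 [c cE]; exists (f - lead_coef f *: 'X^((size f).-1)).
    exact: size_sub_lead_lt.
  by rewrite subKr cE; exists (c *: 'X^((size f).-1)); rewrite mul_polyC scalerA.
move=> f g.
have [m] := ubnP (size f + size g); elim: m f g => // m IH f g lt dfg.
have [->|f0] := eqVneq f 0; first by left; exists 0; rewrite mulr0.
have [->|g0] := eqVneq g 0; first by right; exists 0; rewrite mulr0.
have : divides p (lead_coef f * lead_coef g).
  by rewrite -lead_coefM; move/divides_polyCP: dfg; apply.
case/pp => [/(lead_div _ f0)|/(lead_div _ g0)] [h lth [e eE]].
- have fE : f = h + p%:P * e by rewrite -eE addrC subrK.
  have [||ph|pg] := IH h g; last by right.
  + by rewrite -ltnS (leq_trans _ lt) // !ltnS ltn_add2r.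
  + have [d dE] := dfg; exists (d - e * g).
    by rewrite mulrBr -dE fE mulrDl mulrA addrK.
  + by left; rewrite fE; apply: dividesD => //; exists e.
- have gE : g = h + p%:P * e by rewrite -eE addrC subrK.
  have [||pf|ph] := IH f h; last 1 first.
  + by right; rewrite gE; apply: dividesD => //; exists e.
  + by rewrite -ltnS (leq_trans _ lt) // !ltnS ltn_add2l.
  + have [d dE] := dfg; exists (d - e * f).
    rewrite mulrBr -dE gE mulrDr [f * (_ * _)]mulrC -[p%:P * e * f]mulrA.
    by rewrite addrK.
  + by left.
Qed.

(** Over a field there are no primes and even 0 is primitive, so [f != 0] is asked separately where
    it matters. *)
Definition primitive_poly f : Prop := forall p, prime_elt p -> ~ divides p%:P f.

Hypothesis factR : forall a, a != 0 -> has_factorization a.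

(** Each prime factor of c divides the product of f and the quotient but not the primitive f, so it
    cancels from the quotient. *)
Lemma primitive_cancel f h c : primitive_poly f -> c != 0 ->
  divides f (c%:P * h) -> divides f h.
Proof.
move=> prf /factR[u [s [uu sp ->]]]; elim: s sp => [|p s IH] sp.
  rewrite big_nil mulr1 => [[k kE]]; exists (u^-1%:P * k).
  by rewrite mulrCA -kE mulrA -polyCM mulVr // mul1r.
rewrite big_cons mulrCA polyCM -mulrA => [[k kE]].
have pp : prime_elt p by apply: sp; rewrite mem_head.
have [_ _ pP] := prime_polyC pp; have [|/(prf _ pp)[]|[e eE]] := pP f k.
  by exists ((u * \prod_(j <- s) j)%:P * h).
apply: IH => [q qs|]; first by apply: sp; rewrite inE qs orbT.
exists e; apply: (@mulfI _ p%:P); first by rewrite polyC_eq0; case: pp.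
by rewrite kE eE mulrCA.
Qed.

(** Gauss's lemma distributes the prime factors of c over g and h; only nonzero constants are
    removed, so the sizes stay. This brings a factorization over the fraction field down to R. *)
Lemma const_mul_split f g h c : c != 0 -> c%:P * f = g * h ->
  exists g' h' d, [/\ f = g' * h', d != 0, h = d%:P * h', size g = size g' &
    size h = size h'].
Proof.
move=> /factR[u [s [uu sp ->]]]; elim: s f g h sp => [|p s IH] f g h sp.
  rewrite big_nil mulr1 => E; exists (u^-1%:P * g), h, 1.
  rewrite mul1r oner_neq0 -mulrA -E mulrA -polyCM mulVr // mul1r; split=> //.
  rewrite mul_polyC size_scale // invr_eq0.
  by apply: contraTneq uu => ->; rewrite unitr0.
rewrite big_cons mulrCA polyCM -mulrA => E.
have pp : prime_elt p by apply: sp; rewrite mem_head.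
have p0 : p%:P != 0 by rewrite polyC_eq0; case: pp.
have sp' q : q \in s -> prime_elt q by move=> qs; apply: sp; rewrite inE qs orbT.
have [_ _ pP] := prime_polyC pp; have [|[e eE]|[e eE]] := pP g h.
- by rewrite -E; exists ((u * \prod_(j <- s) j)%:P * f).
- have [|g' [h' [d [fE d0 hE sg sh]]]] := IH f e h sp'.
    by apply: (mulfI p0); rewrite E eE mulrA.
  exists g', h', d; split=> //.
  by rewrite -sg eE mul_polyC size_scale //; case: pp.
- have [|g' [h' [d [fE d0 hE sg sh]]]] := IH f g e sp'.
    by apply: (mulfI p0); rewrite E eE mulrCA.
  exists g', h', (p * d); split=> //.
  + by rewrite mulf_neq0 //; case: pp.
  + by rewrite eE hE polyCM mulrA.
  + by rewrite eE mul_polyC size_scale //; case: pp.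
Qed.

(** Each prime taken out of f shortens the factorization of the leading coefficient, so the
    extraction of the content stops. *)
Lemma primitive_part f : f != 0 ->
  exists c g, [/\ c != 0, primitive_poly g & f = c%:P * g].
Proof.
move=> f0; have := f0; rewrite -lead_coef_eq0 => /factR[u [s [uu sp E]]].
have [m] := ubnP (size s); elim: m u s f f0 uu sp E => // m IH u s f f0 uu sp E lt.
have [prf|/existsNP[p /not_implyP[pp /contrapT[g gE]]]] := pselect (primitive_poly f).
  by exists 1, f; rewrite oner_neq0 mul1r.
have [|v [t [vu tp lE lts]]] :=
  @factorization_div_prime _ p (lead_coef g) u s pp uu sp.
  by rewrite -E gE lead_coefM lead_coefC.
have g0 : g != 0 by apply: contraNneq f0 => g0; rewrite gE g0 mulr0.
have [c [h [c0 prh hE]]] := IH v t g g0 vu tp lE (leq_trans lts lt).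
exists (p * c), h; split=> //; last by rewrite gE hE polyCM mulrA.
by rewrite mulf_neq0 //; case: pp.
Qed.

Lemma primitive_const_unit f c : primitive_poly f -> c != 0 ->
  divides c%:P f -> c \is a GRing.unit.
Proof.
move=> prf c0 cf; apply: contraT => /(prime_divisor (factR c0))[p pp [d cE]].
by case: (prf p pp); apply: divides_trans cf; exists d%:P; rewrite cE polyCM.
Qed.

(* Divisibility [%|] in polydiv is divisibility over the fraction field, where
   f is irreducible; primitivity of f brings the quotients back to R. *)
Lemma prime_of_irreducible f : primitive_poly f -> (1 < size f)%N ->
  (forall g h, f = g * h -> (size g <= 1)%N \/ (size h <= 1)%N) ->
  prime_elt f.
Proof.
move=> prf sf irr; have f0 : f != 0 by rewrite -size_poly_gt0 ltnW.
split=> //; first by rewrite poly_unitE negb_and gtn_eqF.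
move=> g h [k kE].
have up (q : {poly R}) : (f %| q)%R -> divides f q.
  move=> /Pdiv.WeakIdomain.dvdpP[[c r] /= c0 E]; apply: (primitive_cancel prf c0).
  by rewrite mul_polyC E; exists r; rewrite mulrC.
have fgh : (f %| g * h)%R by rewrite kE dvdp_mulr.
have [cop|] := boolP (coprimep f g).
  by right; apply: up; rewrite -(Gauss_dvdpr h cop).
rewrite /coprimep => sd; left; apply: up.
have /Pdiv.WeakIdomain.dvdpP[[c q] /= c0 E] := dvdp_gcdl f g.
have [g' [h' [d [fE d0 hE sg sh]]]] := const_mul_split c0 (etrans (mul_polyC _ _) E).
have d'0 : gcdp f g != 0 by rewrite gcdp_eq0 negb_and f0.
have [sg1|sh1] := irr _ _ fE; last first.
  by move: sd; rewrite sh eqn_leq sh1 -sh size_poly_gt0 d'0.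
apply: dvdp_trans (dvdp_gcdr f g).
have [e gE] : exists e, g' = e%:P by exists g'`_0; exact: size1_polyC.
have e0 : e != 0 by apply: contraNneq f0 => e0; rewrite fE gE e0 mul0r.
rewrite hE fE gE !mul_polyC dvdpZl // dvdpZr //.
Qed.

(** Induction on the size: a primitive constant is a unit, an irreducible primitive polynomial is
    prime, and a reducible one has two smaller factors that are again primitive. *)
Lemma primitive_has_factorization f : primitive_poly f -> f != 0 ->
  has_factorization f.
Proof.
have [m] := ubnP (size f); elim: m f => // m IH f lt prf f0.
have [/size1_polyC fE|sf] := leqP (size f) 1.
  apply: has_factorization_unit; rewrite fE poly_unitE coefC /=.
  have c0 : f`_0 != 0 by rewrite -polyC_eq0 -fE.
  rewrite size_polyC c0; apply: primitive_const_unit prf c0 _.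
  by exists 1; rewrite mulr1.
have [irr|] := pselect (forall g h, f = g * h -> (size g <= 1)%N \/ (size h <= 1)%N).
  exact/has_factorization_prime/prime_of_irreducible.
move=> /existsNP[g /existsNP[h /not_implyP[fE /not_orP[/negP + /negP]]]].
rewrite -!ltnNge => sg sh.
have g0 : g != 0 by apply: contraNneq f0 => g0; rewrite fE g0 mul0r.
have h0 : h != 0 by apply: contraNneq f0 => h0; rewrite fE h0 mulr0.
have sfE : size f = (size g + size h).-1 by rewrite fE size_mul.
rewrite fE; apply: has_factorizationM; apply: IH => //.
- rewrite -ltnS; apply: leq_trans lt; rewrite ltnS sfE -ltnS prednK.
    by rewrite -addn2 leq_add2l.
  by rewrite addn_gt0 ltnW.
- by move=> p pp pg; apply: (prf p pp); rewrite fE; exact: divides_mull.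
- rewrite -ltnS; apply: leq_trans lt; rewrite ltnS sfE -ltnS prednK.
    by rewrite addnC -addn2 leq_add2l.
  by rewrite addn_gt0 ltnW.
- by move=> p pp pg; apply: (prf p pp); rewrite fE; exact: divides_mulr.
Qed.

Lemma poly_has_factorization f : f != 0 -> has_factorization f.
Proof.
move=> f0; have [c [g [c0 prg fE]]] := primitive_part f0.
rewrite fE; apply: has_factorizationM; last first.
  apply: primitive_has_factorization => //.
  by apply: contraNneq f0 => g0; rewrite fE g0 mulr0.
have [u [s [uu sp cE]]] := factR c0.
exists u%:P, (map polyC s); split.
- by rewrite rmorph_unit.
- by move=> _ /mapP[p ps ->]; exact/prime_polyC/sp.
- by rewrite cE polyCM big_map rmorph_prod.
Qed.

End GaussLemma.

Lemma mpoly_ring_ind n (R : idomainType) (P : {mpoly R[n]} -> Prop) :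
  (forall c, P c%:MP) -> (forall i, P 'X_i) ->
  (forall p q, P p -> P q -> P (p + q)) ->
  (forall p q, P p -> P q -> P (p * q)) -> forall p, P p.
Proof.
move=> PC PX PD PM; apply: mpolyind => [|c m p _ _ Pp].
  by rewrite -mpolyC0.
apply: PD => //; rewrite -mul_mpolyC; apply: (PM) => //.
rewrite mpolyXE_id; apply: (big_ind P) => [|p1 p2|i _]; [exact: (PC 1) | exact: PM |].
elim: {m}(m i) => [|k IH]; first exact: (PC 1).
by rewrite exprS; exact: PM.
Qed.

(** * Polynomials in n + 1 variables as polynomials in the last one *)

Section MPolyAsPoly.
Variables (n : nat) (R : idomainType).
Local Notation A := {mpoly R[n]}.
Local Notation widen := (widen_ord (leqnSn n)).

Lemma muniXmax : muni ('X_ord_max : {mpoly R[n.+1]}) = 'X.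
Proof.
rewrite muniE msuppX big_seq1 mcoeffX eqxx scale1r mnm1E eqxx expr1.
rewrite (_ : [multinom _ | _ < _] = 0%MM) ?mpolyX0 ?scale1r //.
by apply/mnmP => i; rewrite !mnmE -val_eqE /= gtn_eqF.
Qed.

Lemma muniXwiden i : muni ('X_(widen i) : {mpoly R[n.+1]}) = ('X_i)%:P.
Proof.
rewrite muniE msuppX big_seq1 mcoeffX eqxx scale1r mnm1E -val_eqE /= ltn_eqF //.
rewrite expr0 alg_polyC; congr (_%:P); congr 'X_[_].
by apply/mnmP => j; rewrite !mnmE.
Qed.

Lemma muni_mwiden (a : A) : muni (mwiden a) = a%:P.
Proof.
elim/mpoly_ring_ind: a => [c|i|p q pE qE|p q pE qE].
- by rewrite mwidenC muniC.
- by rewrite mwidenX mnmwiden1 muniXwiden.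
- by rewrite mwidenD muniD pE qE polyCD.
- by rewrite mwidenM muniM pE qE polyCM.
Qed.

(** The inverse of [muni], written as an evaluation at the last variable so that it is a ring
    morphism by construction. *)
Definition munpoly : {poly A} -> {mpoly R[n.+1]} :=
  horner_eval ('X_ord_max : {mpoly R[n.+1]}) \o map_poly (@mwiden n R).

HB.instance Definition _ := GRing.RMorphism.on munpoly.

Lemma munpolyD : {morph munpoly : p q / p + q}.
Proof. exact: rmorphD. Qed.

Lemma munpolyB : {morph munpoly : p q / p - q}.
Proof. exact: rmorphB. Qed.

Lemma munpolyM : {morph munpoly : p q / p * q}.
Proof. exact: rmorphM. Qed.

Lemma munpolyC a : munpoly a%:P = mwiden a.
Proof. by rewrite /munpoly /= map_polyC horner_evalE hornerC. Qed.

Lemma munpolyX : munpoly 'X = 'X_ord_max.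
Proof. by rewrite /munpoly /= map_polyX horner_evalE hornerX. Qed.

Lemma munpolyK : cancel munpoly (@muni n R).
Proof.
elim/poly_ind => [|q c IH]; first by rewrite !rmorph0.
by rewrite munpolyD munpolyM munpolyX munpolyC muniD muniM IH muniXmax muni_mwiden.
Qed.

Lemma muniK : cancel (@muni n R) munpoly.
Proof.
elim/mpoly_ring_ind => [c|i|p q pE qE|p q pE qE].
- by rewrite muniC munpolyC mwidenC.
- have [lt|] := ltnP i n; last first.
    move=> ge; have -> : i = ord_max.
      by apply/val_inj/eqP; rewrite eqn_leq ge -ltnS ltn_ord.
    by rewrite muniXmax munpolyX.
  have -> : i = widen (Ordinal lt) by exact: val_inj.
  by rewrite muniXwiden munpolyC mwidenX mnmwiden1.
- by rewrite muniD munpolyD; congr (_ + _).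
- by rewrite muniM munpolyM; congr (_ * _).
Qed.

End MPolyAsPoly.

Lemma mpoly_const0 (R : nzRingType) (p : {mpoly R[0]}) : p = (p@_0)%:MP.
Proof.
apply/mpolyP => m; have -> : m = 0%MM by apply/mnmP => -[].
by rewrite mcoeffC eqxx mulr1.
Qed.

Lemma mpoly_has_factorization n (C : fieldType) (p : {mpoly C[n]}) : p != 0 ->
  has_factorization p.
Proof.
elim: n p => [|n IH] p p0.
  apply: has_factorization_unit; rewrite (mpoly_const0 p) rmorph_unit //.
  by rewrite unitfE; apply: contraNneq p0 => p0; rewrite (mpoly_const0 p) p0.
apply: (has_factorization_transport (@muniK n C) (@munpolyK n C)).
apply: poly_has_factorization => //.
by rewrite -(rmorph0 (@muni n C)) (can_eq (@muniK n C)).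
Qed.

Lemma mderivXU n (R : nzRingType) (i j : 'I_n) :
  ('X_j : {mpoly R[n]})^`M(i) = (j == i)%:R.
Proof.
rewrite mderivX mnm1E; case: eqP => [->|_]; last by rewrite scale0r.
rewrite scale1r (_ : (_ - _)%MM = 0%MM) ?mpolyX0 //.
by apply/mnmP => k; rewrite !mnmE subnn.
Qed.

Lemma mderiv_mwiden n (R : idomainType) (a : {mpoly R[n]}) (i : 'I_n) :
  (mwiden a)^`M(widen_ord (leqnSn n) i) = mwiden a^`M(i).
Proof.
elim/mpoly_ring_ind: a => [c|j|p q pE qE|p q pE qE].
- by rewrite mwidenC !mderivC mwiden0.
- by rewrite mwidenX mnmwiden1 !mderivXU rmorph_nat.
- by rewrite mwidenD !mderivD mwidenD pE qE.
- by rewrite mwidenM !mderivM mwidenD !mwidenM pE qE.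
Qed.

Lemma mderiv_mwiden_max n (R : idomainType) (a : {mpoly R[n]}) :
  (mwiden a)^`M(ord_max) = 0.
Proof.
elim/mpoly_ring_ind: a => [c|j|p q pE qE|p q pE qE].
- by rewrite mwidenC mderivC.
- by rewrite mwidenX mnmwiden1 mderivXU -val_eqE /= ltn_eqF.
- by rewrite mwidenD mderivD pE qE addr0.
- by rewrite mwidenM mderivM pE qE mul0r mulr0 addr0.
Qed.

Lemma mderiv_munpoly_max n (R : idomainType) (q : {poly {mpoly R[n]}}) :
  (munpoly q)^`M(ord_max) = munpoly q^`().
Proof.
elim/poly_ind: q => [|q c IH]; first by rewrite rmorph0 mderiv0 deriv0 rmorph0.
rewrite derivD derivC addr0 derivM derivX mulr1.
rewrite !rmorphD !rmorphM /= mderivD mderivM IH !munpolyC mderiv_mwiden_max addr0.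
by rewrite munpolyX mderivXU eqxx mulr1.
Qed.

(** * Prime ideals on which gradients have rank at most one *)

Section PrimeIdeals.
Variable C : numFieldType.

Definition prime_ideal n (I : {mpoly C[n]} -> Prop) : Prop :=
  [/\ ~ I 1, forall f g, I f -> I g -> I (f + g),
      forall f g, I g -> I (f * g) & forall f g, I (f * g) -> I f \/ I g].

(** The gradients of any two elements of I are proportional modulo I: the infinitesimal form of
    height at most one. *)
Definition closed_under_minors n (I : {mpoly C[n]} -> Prop) : Prop :=
  forall f g i j, I f -> I g -> I (f^`M(i) * g^`M(j) - f^`M(j) * g^`M(i)).

Lemma mderiv0_const n (p : {mpoly C[n]}) :
  (forall i, p^`M(i) = 0) -> p = (p@_0)%:MP.
Proof.
move=> dp; apply/mpolyP => m; rewrite mcoeffC.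
have [->|m0] := eqVneq m 0%MM; first by rewrite mulr1.
rewrite mulr0.
have [i mi] : exists i, (0 < m i)%N.
  apply: contrapT => H; case/eqP: m0; apply/mnmP => i; rewrite mnm0E.
  by apply/eqP; rewrite -leqn0 leqNgt; apply/negP => mi; apply: H; exists i.
have := congr1 (mcoeff (m - U_(i))%MM) (dp i).
rewrite mcoeff_mderiv mcoeff0 submK; last by rewrite lep1mP -lt0n.
by move/eqP; rewrite mulrn_eq0 /= => /eqP.
Qed.

Lemma msize_mderiv_lt n (p : {mpoly C[n]}) i : p^`M(i) != 0 ->
  (msize p^`M(i) < msize p)%N.
Proof.
move=> dp0; rewrite -(mlead_deg dp0).
have : p@_(mlead p^`M(i) + U_(i)) != 0.
  have := mleadc_eq0 p^`M(i); rewrite (negPf dp0) mcoeff_mderiv mulrn_eq0 /=.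
  by move=> ->.
rewrite -mcoeff_msupp => /msize_mdeg_lt.
by rewrite mdegD mdeg1 addn1.
Qed.

(** If I were stable under all partial derivatives, differentiating a nonzero element down to a
    nonzero constant would put a unit in I. *)
Lemma deriv_notin_prime_ideal n (I : {mpoly C[n]} -> Prop) f :
  prime_ideal I -> I f -> f != 0 -> exists g i, I g /\ ~ I g^`M(i).
Proof.
move=> [I1 _ IM _] If f0; apply: contrapT => H.
have dI g i : I g -> I g^`M(i).
  by move=> Ig; apply: contrapT => dg; apply: H; exists g, i.
have [m] := ubnP (msize f); elim: m f If f0 => // m IH f If f0 lt.
have [[i di]|nd] := pselect (exists i, f^`M(i) != 0).
  apply: (IH f^`M(i)) => //; first exact: dI.
  by rewrite -ltnS (leq_trans _ lt) // ltnS msize_mderiv_lt.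
have fE : f = (f@_0)%:MP.
  by apply: mderiv0_const => i; apply/eqP/negPn/negP => di; apply: nd; exists i.
apply: I1; have := IM (f@_0)^-1%:MP f If; rewrite {2}fE -mpolyCM mulVf ?mpolyC1 //.
by apply: contraNneq f0 => c0; rewrite fE c0.
Qed.

(* The Jacobian criterion for height at most one.  With I0 the contraction of I
   to the first n variables: either I0 <> 0, and the minors involving the last
   variable show that I is stable under the last derivation, hence generated by
   I0; or I0 = 0, and I is generated by a primitive element of least degree in
   the last variable. *)
Lemma principal_of_minors n (I : {mpoly C[n]} -> Prop) :
  prime_ideal I -> closed_under_minors I ->
  exists f, forall h, I h -> I f /\ divides f h.
Proof.
elim: n I => [|n IH] I pI mI; have [I1 ID IM IP] := pI.
  (* [prime_ideal] does not assert that 0 is in I, so membership of the generator is claimed only in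
     the presence of some h in I. *)
  exists 0 => h Ih; suff h0 : h = 0.
    by rewrite -{1}h0; split=> //; exists 0; rewrite mulr0.
  apply: contrapT => /eqP h0; have [g [[]//]] := deriv_notin_prime_ideal pI Ih h0.
pose I0 a := I (mwiden a : {mpoly C[n.+1]}).
have pI0 : prime_ideal I0.
  split; rewrite /I0 ?mwiden1 // => f g; rewrite ?mwidenD ?mwidenM.
  - exact: ID.
  - exact: IM.
  - exact: IP.
have mI0 : closed_under_minors I0.
  move=> f g i j If Ig; rewrite /I0 mwidenB !mwidenM -!mderiv_mwiden.
  exact: mI.
suff [f fP] : exists f : {poly {mpoly C[n]}}, forall h, I (munpoly h) ->
    I (munpoly f) /\ divides f h.
  exists (munpoly f) => h Ih; rewrite -(muniK h) in Ih *.
  have [If [k kE]] := fP _ Ih; split=> //.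
  by exists (munpoly k); rewrite -munpolyM -kE.
have IB f g : I f -> I g -> I (f - g).
  by move=> If Ig; apply: ID => //; rewrite -mulN1r; exact: IM.
have I_natK (g : {mpoly C[n.+1]}) k : (0 < k)%N -> I (g *+ k) -> I g.
  move=> k0 /(IM (k%:R^-1)%:MP); rewrite mulrnAr -mulrnAl -mpolyCMn.
  have -> : (k%:R^-1 : C) *+ k = 1.
    by rewrite -[LHS]mulr_natr mulVf // pnatr_eq0 -lt0n.
  by rewrite mpolyC1 mul1r.
have [[a [Ia a0]]|I00] := pselect (exists a, I0 a /\ a != 0).
  have [g [i [Ig dg]]] := deriv_notin_prime_ideal pI0 Ia a0.
  have dI (q : {poly {mpoly C[n]}}) : I (munpoly q) -> I (munpoly q^`()).
    move=> Iq; have := mI _ _ (widen_ord (leqnSn n) i) ord_max Ig Iq.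
    rewrite mderiv_mwiden_max mul0r subr0 mderiv_munpoly_max mderiv_mwiden.
    by case/IP.
  (* Differentiating deg q times leaves the leading coefficient times a factorial, so this
     coefficient is in I0; its term is subtracted and the argument repeats. *)
  have cI (q : {poly {mpoly C[n]}}) : I (munpoly q) -> forall k, I0 q`_k.
    have [m] := ubnP (size q); elim: m q => // m IHm q lt Iq k.
    have I00 : I0 0 by rewrite /I0 mwiden0 -[0](mul0r (mwiden g)); exact: IM.
    have [->|q0] := eqVneq q 0; first by rewrite coef0.
    have Ilead : I0 (lead_coef q).
      have dn s : I (munpoly q^`(s)).
        by elim: s => [|s IHs]; rewrite ?derivn0 // derivnS; exact: dI.
      have := dn (size q).-1; set s := (size q).-1.
      have -> : q^`(s) = (lead_coef q *+ s`!)%:P.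
        apply/polyP => j; rewrite coef_derivn coefC.
        case: j => [|j] /=; first by rewrite addn0 ffactnn.
        rewrite nth_default ?mul0rn // addnS -addSn /s prednK ?size_poly_gt0 //.
        exact: leq_addr.
      by rewrite munpolyC mwidenMn; apply: I_natK; exact: fact_gt0.
    pose r := q - lead_coef q *: 'X^((size q).-1).
    have Ir : I (munpoly r).
      rewrite /r munpolyB; apply: IB => //; rewrite -mul_polyC munpolyM mulrC.
      by apply: IM; rewrite munpolyC.
    have ltr : (size r < m)%N.
      by rewrite -ltnS (leq_trans _ lt) // ltnS size_sub_lead_lt.
    have -> : q = r + lead_coef q *: 'X^((size q).-1) by rewrite subrK.
    rewrite coefD /I0 mwidenD; apply: ID; first exact: IHm.
    by rewrite coefZ mulrC mwidenM; exact: IM.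
  have [f fP] := IH I0 pI0 mI0.
  exists f%:P => h Ih; split; first by rewrite munpolyC; have [] := fP a Ia.
  by apply/divides_polyCP => k; have [] := fP _ (cI _ Ih k).
have [[q0 [Iq0 q00]]|Iz] := pselect (exists q, I (munpoly q) /\ q != 0); last first.
  exists 0 => h Ih; suff h0 : h = 0.
    by rewrite -{1}h0; split=> //; exists 0; rewrite mulr0.
  by apply: contrapT => /eqP h0; apply: Iz; exists h.
pose P m := `[< exists q, [/\ I (munpoly q), q != 0 & size q = m] >].
have [m /asboolP[q [Iq qn0 sq]] mmin] :=
  ex_minnP (ex_intro P (size q0) (asboolT (ex_intro _ q0 (And3 Iq0 q00 erefl)))).
have fac := @mpoly_has_factorization n C.
(* No nonzero polynomial in the first n variables is in I, so the content c drops out and the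
   primitive part, of the same degree, is in I. *)
have [c [f [c0 prf qE]]] := primitive_part fac qn0.
have f0 : f != 0 by apply: contraNneq qn0 => f0; rewrite qE f0 mulr0.
have If : I (munpoly f).
  move: Iq; rewrite qE munpolyM munpolyC => /IP[Ic|//].
  by case: I00; exists c.
have sf : size f = m by rewrite -sq qE mul_polyC size_scale.
exists f => h Ih; split=> //.
(* Pseudo-division: the remainder is in I and has degree below the minimum, so it vanishes.
   Primitivity of f then removes the power of its leading coefficient. *)
have E := Pdiv.WeakIdomain.divp_eq h f.
have Ir : I (munpoly (h %% f)%R).
  have -> : (h %% f)%R = lead_coef f ^+ scalp h f *: h - (h %/ f)%R * f.
    by rewrite E addrC addKr.
  rewrite munpolyB -mul_polyC !munpolyM; apply: IB; exact: IM.
have r0 : (h %% f)%R = 0.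
  apply: contrapT => /eqP r0; have : (m <= size (h %% f)%R)%N.
    by apply: mmin; apply/asboolP; exists (h %% f)%R.
  by rewrite leqNgt -sf ltn_modp f0.
apply: (primitive_cancel fac prf (c := lead_coef f ^+ scalp h f)).
  by rewrite expf_neq0 // lead_coef_eq0.
by rewrite mul_polyC E r0 addr0; exists (h %/ f)%R; rewrite mulrC.
Qed.

End PrimeIdeals.

(** * Keller maps *)

Section KellerMap.
Variables (C : numFieldType) (n : nat).
Local Notation P := {mpoly C[n]}.
Variable F : {lrmorphism P -> P}.

Lemma lrmorph_mpolyC c : F c%:MP = c%:MP.
Proof. by rewrite -[c%:MP]mulr1 mul_mpolyC linearZ /= rmorph1. Qed.

Lemma mderiv_lrmorph p l :
  (F p)^`M(l) = \sum_j F p^`M(j) * (F 'X_j)^`M(l).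
Proof.
elim/mpoly_ring_ind: p => [c|i|p q pE qE|p q pE qE].
- rewrite lrmorph_mpolyC mderivC big1 // => j _.
  by rewrite mderivC rmorph0 mul0r.
- rewrite (bigD1 i) //= big1 ?addr0 => [|j ji].
    by rewrite mderivXU eqxx rmorph1 mul1r.
  by rewrite mderivXU eq_sym (negPf ji) rmorph0 mul0r.
- rewrite rmorphD mderivD pE qE -big_split; apply: eq_bigr => j _.
  by rewrite mderivD rmorphD mulrDl.
- rewrite rmorphM mderivM pE qE mulr_suml mulr_sumr -big_split.
  apply: eq_bigr => j _; rewrite mderivM rmorphD !rmorphM /=.
  by rewrite mulrDl mulrAC -!mulrA.
Qed.

Definition jacobian_mx : 'M[P]_n := \matrix_(i, j) (F 'X_i)^`M(j).

Variable c : C.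
Hypotheses (c0 : c != 0) (detJ : \det jacobian_mx = c%:MP).

(** The entry (l, k) plays the role of d x_l / d F_k; it is a polynomial because the determinant is
    the constant c. *)
Definition inv_jacobian_mx : 'M[P]_n := c^-1%:MP *: \adj jacobian_mx.

Lemma mul_jacobian_inv : jacobian_mx *m inv_jacobian_mx = 1%:M.
Proof.
rewrite -scalemxAr mul_mx_adj detJ scale_scalar_mx -mpolyCM mulVf //.
Qed.

(* The partial derivatives with respect to F_1, ..., F_n. *)
Definition image_deriv (k : 'I_n) (p : P) : P :=
  \sum_l inv_jacobian_mx l k * p^`M(l).

Lemma image_derivD k : {morph image_deriv k : p q / p + q}.
Proof.
move=> p q; rewrite /image_deriv -big_split; apply: eq_bigr => l _.
by rewrite mderivD mulrDr.
Qed.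

Lemma image_derivM k p q :
  image_deriv k (p * q) = image_deriv k p * q + p * image_deriv k q.
Proof.
rewrite /image_deriv mulr_suml mulr_sumr -big_split; apply: eq_bigr => l _.
rewrite mderivM mulrDr .
by rewrite -mulrA [p * (_ * _)]mulrCA.
Qed.

Lemma image_deriv_lrmorph k p : image_deriv k (F p) = F p^`M(k).
Proof.
rewrite /image_deriv.
under eq_bigr => l _ do rewrite mderiv_lrmorph mulr_sumr.
rewrite exchange_big /=.
transitivity (\sum_j F p^`M(j) * (jacobian_mx *m inv_jacobian_mx) j k).
  apply: eq_bigr => j _; rewrite mxE mulr_sumr; apply: eq_bigr => l _.
  by rewrite [jacobian_mx j l]mxE mulrC -mulrA.
rewrite mul_jacobian_inv (bigD1 k) //= mxE eqxx mulr1 big1 ?addr0 // => j jk.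
by rewrite mxE (negPf jk) mulr0.
Qed.

(** Applying d/dF_k to F(p) = 0 gives F(d p / d x_k) = 0, so by induction on the degree all partial
    derivatives of p vanish; p is then a constant, which F fixes. *)
Lemma keller_eq0 p : F p = 0 -> p = 0.
Proof.
have [m] := ubnP (msize p); elim: m p => // m IH p lt Fp.
have dp i : p^`M(i) = 0.
  apply: contrapT => /eqP dp; case/eqP: (dp); apply: IH.
    by rewrite -ltnS (leq_trans _ lt) // ltnS msize_mderiv_lt.
  rewrite -image_deriv_lrmorph Fp /image_deriv big1 // => l _.
  by rewrite mderiv0 mulr0.
have pE := mderiv0_const dp.
by move: Fp; rewrite pE lrmorph_mpolyC.
Qed.

Lemma keller_inj : injective F.
Proof.
move=> p q E; apply/eqP; rewrite -subr_eq0; apply/eqP/keller_eq0.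
by rewrite rmorphB /= E subrr.
Qed.

Lemma mpoly_unit_const (u : P) : u \is a GRing.unit -> exists e, u = e%:MP.
Proof. by case/andP => /eqP-> _; exists u@_0. Qed.

(* If x_i = F(u) / F(v) with v of least degree and non constant, a prime factor
   g of F(v) contracts to a prime ideal containing u and v.  On multiples of g
   the gradients with respect to the F_k are proportional modulo g, so that
   this ideal is principal, and its generator cancels from u and v. *)
Lemma keller_denominator (x u v : P) : v != 0 -> F v * x = F u ->
  exists w, F w = x.
Proof.
have [m] := ubnP (msize v); elim: m u v => // m IH u v lt v0 E.
have [sv|sv] := leqP (msize v) 1.
  have vE := msize1_polyC sv.
  have e0 : v@_0 != 0 by apply: contraNneq v0 => e0; rewrite vE e0 mpolyC0.
  exists ((v@_0)^-1%:MP * u); rewrite rmorphM /= -E lrmorph_mpolyC vE lrmorph_mpolyC.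
  by rewrite mcoeffC eqxx mulr1 mulrA -mpolyCM mulVf // mpolyC1 mul1r.
have Fv0 : F v != 0 by apply: contraNneq v0 => /keller_eq0->.
have Fvu : F v \isn't a GRing.unit.
  apply: contraL sv => /mpoly_unit_const[e]; rewrite -lrmorph_mpolyC.
  by move=> /keller_inj ->; rewrite msizeC -leqNgt; case: (e == 0).
have [g [g0 gu gp] gv] := prime_divisor (mpoly_has_factorization Fv0) Fvu.
pose I f := divides g (F f).
have pI : prime_ideal I.
  split; rewrite /I.
  - by rewrite rmorph1 => /(divides_unitr (unitr1 _)); rewrite (negPf gu).
  - by move=> f h; rewrite rmorphD; exact: dividesD.
  - by move=> f h; rewrite rmorphM; exact: divides_mulr.
  - by move=> f h; rewrite rmorphM; exact: gp.
have mI : closed_under_minors I.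
  move=> f h i j [a fE] [b hE]; rewrite /I rmorphB !rmorphM /=.
  rewrite -!image_deriv_lrmorph fE hE !image_derivM.
  (* By the Leibniz rule the terms without a factor g cancel in the minor; the witness collects the
     remaining ones. *)
  move: (image_deriv i g) (image_deriv j g) (image_deriv i a) (image_deriv j a)
    (image_deriv i b) (image_deriv j b) => Gi Gj Ai Aj Bi Bj.
  exists (Gi * a * Bj + Ai * (Gj * b + g * Bj) - Gj * a * Bi - Aj * (Gi * b + g * Bi)).
  by ring.
have Iu : I u by rewrite /I -E; exact: divides_mull.
have [f fP] := principal_of_minors pI mI.
have [If [v' vE]] := fP v gv; have [_ [u' uE]] := fP u Iu.
have f0 : f != 0 by apply: contraNneq v0 => f0; rewrite vE f0 mul0r.
have v'0 : v' != 0 by apply: contraNneq v0 => v'0; rewrite vE v'0 mulr0.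
apply: (IH u' v') => //; last first.
  apply: (@mulfI _ (F f)); first by apply: contraNneq f0 => /keller_eq0->.
  by rewrite mulrA -!rmorphM -vE -uE.
(* The common factor f is not constant, so cancelling it lowers the degree of the denominator. *)
have sf : (1 < msize f)%N.
  rewrite ltnNge; apply/negP => /msize1_polyC fE; have [I1 _ IM _] := pI.
  apply: I1; have := IM (f@_0)^-1%:MP _ If; rewrite {2}fE -mpolyCM mulVf ?mpolyC1 //.
  by apply: contraNneq f0 => e0; rewrite fE e0.
rewrite -ltnS (leq_trans _ lt) // ltnS vE msizeM //.
by rewrite -ltnS prednK ?addn_gt0 1?(ltnW sf) // -add2n leq_add2r.
Qed.

Lemma keller_birational_bijective :
  (forall i, exists u v, v != 0 /\ F v * 'X_i = F u) -> bijective F.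
Proof.
move=> bir; suff /choice[G GK] : forall p, exists q, F q = p.
  by exists G => // p; apply: keller_inj; rewrite GK.
elim/mpoly_ring_ind => [e|i|_ _ [p <-] [q <-]|_ _ [p <-] [q <-]].
- by exists e%:MP; rewrite lrmorph_mpolyC.
- by have [u [v [v0 E]]] := bir i; exact: keller_denominator v0 E.
- by exists (p + q); rewrite rmorphD.
- by exists (p * q); rewrite rmorphM.
Qed.

End KellerMap.

(** * Derivations of fields *)

Section Derivations.
Variable L : fieldType.
Implicit Types (K E : divringClosed L) (D : L -> L) (p q : {poly L}).

Definition derivation D : Prop := (forall x y, D (x + y) = D x + D y) /\
  (forall x y, D (x * y) = D x * y + x * D y).

Section DerivationTheory.
Variables (D : L -> L) (dD : derivation D).

Lemma derivation0 : D 0 = 0.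
Proof. by apply: (addrI (D 0)); rewrite -dD.1 !addr0. Qed.

Lemma derivation1 : D 1 = 0.
Proof. by apply: (addrI (D 1)); have := dD.2 1 1; rewrite !mulr1 mul1r addr0. Qed.

Lemma derivationN x : D (- x) = - D x.
Proof. by apply: (addrI (D x)); rewrite -dD.1 !subrr derivation0. Qed.

Lemma derivationV x : D x^-1 = - D x / x ^+ 2.
Proof.
have [->|x0] := eqVneq x 0; first by rewrite invr0 derivation0 oppr0 mul0r.
have := derivation1; rewrite -(mulfV x0) dD.2 => /eqP; rewrite addrC addr_eq0.
move=> /eqP E; apply: (mulfI x0); rewrite E mulNr mulrN expr2 invfM; congr (- _).
by rewrite [RHS]mulrCA [x * _]mulrA mulfV // mul1r.
Qed.

Lemma derivation_horner q x :
  D q.[x] = (map_poly D q).[x] + q^`().[x] * D x.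
Proof.
elim/poly_ind: q => [|q c IH].
  by rewrite horner0 deriv0 horner0 mul0r addr0 map_poly0 ?horner0 derivation0.
have -> : map_poly D (q * 'X + c%:P) = map_poly D q * 'X + (D c)%:P.
  apply/polyP => i; rewrite coef_map_id0 ?derivation0 // !coefD !coefMX !coefC.
  by rewrite dD.1 coef_map_id0 ?derivation0 //; case: i => [|i] /=;
    rewrite ?derivation0.
rewrite derivD derivC addr0 derivM derivX mulr1 !hornerE dD.1 dD.2 IH.
by ring.
Qed.

(** By the quotient rule the y with both y and D y in E form a subfield, so only the generators need
    checking. *)
Lemma derivation_subfield (A : set L) E :
  (forall a, A a -> a \in E /\ D a \in E) ->
  forall y, subfield_gen A y -> y \in E /\ D y \in E.
Proof.
move=> AE; apply: (smallest_sub (C := fun S => GRing.divring_closed (mem S))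
  (X := [set y | y \in E /\ D y \in E]%classic)) => [|a /AE//].
split; first by rewrite in_setE /= derivation1 rpred0 rpred1.
- move=> x y; rewrite !in_setE /= => -[xE dxE] [yE dyE].
  by rewrite dD.1 derivationN !rpredB.
- move=> x y; rewrite !in_setE /= => -[xE dxE] [yE dyE].
  by rewrite dD.2 derivationV rpredD ?rpredM ?rpredV ?rpredN ?rpredX.
Qed.

End DerivationTheory.

Hypothesis char0 : forall k, k.+1%:R != 0 :> L.

(** Implicit differentiation of p(x) = 0 expresses D x through the coefficients and x. The
    denominator p'(x) is nonzero by minimality of p, since p' is a nonzero polynomial in
    characteristic 0. *)
Lemma derivation_algebraic D K E x p : derivation D ->
  {subset K <= E} -> (forall y, y \in K -> D y \in E) -> x \in E ->
  p \is a polyOver K -> root p x -> (1 < size p)%N ->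
  (forall q, q != 0 -> q \is a polyOver K -> root q x -> (size p <= size q)%N) ->
  D x \in E.
Proof.
move=> dD KE DKE xE pK /rootP px sp pmin.
have p'K : p^`() \is a polyOver K by exact: polyOver_deriv.
have p'x : p^`().[x] != 0.
  apply/negP => p'x; have := pmin p^`() _ p'K p'x.
  rewrite leqNgt lt_size_deriv ?implybF => [H|]; last first.
    by rewrite -size_poly_gt0 ltnW.
  have : p^`() != 0; last by move/H.
  have [k sk] : exists k, size p = k.+2.
    by exists (size p).-2; case: (size p) sp => [|[]].
  apply/eqP => /(congr1 (fun q : {poly L} => q`_k)); rewrite coef_deriv coef0.
  move=> /eqP; rewrite -mulr_natr mulf_eq0 (negPf (char0 _)) orbF.
  have -> : p`_k.+1 = lead_coef p by rewrite lead_coefE sk.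
  by rewrite lead_coef_eq0 -size_poly_eq0 sk.
have := derivation_horner dD p x; rewrite px derivation0 // => /esym/eqP.
rewrite addrC addr_eq0 => /eqP E1.
have -> : D x = - (map_poly D p).[x] / p^`().[x].
  by rewrite -E1 [_ * D x]mulrC mulfK.
rewrite rpredM ?rpredV ?rpredN //; apply: rpred_horner => //.
  apply/polyOverP => i; rewrite coef_map_id0 ?derivation0 //.
  exact/DKE/(polyOverP pK).
by apply/polyOverP => i; exact/KE/(polyOverP p'K).
Qed.

(* Differentiating p(x) = 0 gives a relation of degree less than deg p over E,
   hence a trivial one; its top coefficient is D p_(d-1) + d. *)
Lemma derivation_trace D K E x d p : derivation D ->
  {subset K <= E} -> (forall y, y \in K -> D y \in E) -> D x = 1 ->
  p \is a polyOver K -> p \is monic -> root p x -> size p = d.+2 ->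
  free_over E (@powers L x d.+1) -> D (x + p`_d / d.+1%:R) = 0.
Proof.
move=> dD KE DKE Dx pK mp /rootP px sp fx.
(* Here p has degree d + 1. Since D x = 1, q(x) is D(p(x)) = 0; D kills the leading coefficient 1,
   so q has degree at most d. *)
pose q := map_poly D p + p^`().
have pd : p`_d.+1 = 1 by rewrite -(monicP mp) lead_coefE sp.
have qc i : q`_i = D p`_i + p`_i.+1 *+ i.+1.
  by rewrite coefD coef_map_id0 ?derivation0 // coef_deriv.
have sq : (size q <= d.+1)%N.
  apply/leq_sizeP => j; rewrite leq_eqVlt qc => /orP[/eqP<-|lt].
    by rewrite pd derivation1 // nth_default ?mul0rn ?addr0 // sp.
  by rewrite !nth_default ?sp ?derivation0 ?mul0rn ?addr0 // ltnW.
have q0 : \sum_(i < d.+1) q`_i * powers x i = 0.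
  rewrite /powers -(horner_coef_wide x sq) hornerD -[_.[x] in X in _ + X]mulr1.
  by rewrite -Dx -derivation_horner // px derivation0.
have /= := fx _ _ q0 ord_max; rewrite qc pd => E1.
rewrite dD.1 dD.2 (derivationV dD).
have -> : D d.+1%:R = 0.
  elim: d.+1 => [|k IH]; first exact: derivation0.
  by rewrite -[k.+1]addn1 natrD dD.1 IH (derivation1 dD) addr0.
rewrite oppr0 mul0r mulr0 addr0 Dx; apply: (mulIf (char0 d)).
rewrite mul0r mulrDl divfK // mul1r addrC E1 // => i.
rewrite qc rpredD ?rpredMn ?DKE ?KE //; exact: (polyOverP pK).
Qed.

(** Algebraicity rules out the default value 0 of [minpoly_over]: a nonzero annihilating polynomial
    of least size, made monic, qualifies. The bundled K replaces S so that closure lemmas apply. *)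
Lemma minpoly_overP (S : set L) K x : S =i K ->
  (exists q, [/\ q != 0, q \is a polyOver K & root q x]) ->
  exists p, [/\ p \is monic, p \is a polyOver K, root p x,
    size p = (minpoly_degree S x).+1 &
    forall q, q != 0 -> q \is a polyOver K -> root q x -> (size p <= size q)%N].
Proof.
move=> SK [q0 [q00 q0K q0x]].
have SKp (q : {poly L}) : (q \is a polyOver (mem S)) = (q \is a polyOver K).
  by apply: eq_all => y; exact: SK.
have : is_minpoly_over S x (minpoly_over S x).
  rewrite /minpoly_over; case: xgetP => [p -> //|nop].
  pose P m := `[< exists q, [/\ q != 0, q \is a polyOver K, root q x & size q = m] >].
  have [m /asboolP[q [qn0 qK qx sq]] mmin] :=
    ex_minnP (ex_intro P (size q0) (asboolT (ex_intro _ q0 (And4 q00 q0K q0x erefl)))).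
  case: (nop ((lead_coef q)^-1 *: q)); split.
  - by rewrite monicE lead_coefZ mulVf // lead_coef_eq0.
  - rewrite SKp polyOverZ // rpredV lead_coefE; exact: (polyOverP qK).
  - by rewrite rootZ // invr_eq0 lead_coef_eq0.
  - move=> r r0 rK rx; rewrite size_scale ?invr_eq0 ?lead_coef_eq0 // sq.
    by apply: mmin; apply/asboolP; exists r; rewrite -SKp.
rewrite /minpoly_degree; set p := minpoly_over S x => -[mp pK px pmin].
exists p; split=> //; first by rewrite -SKp.
- by rewrite prednK // size_poly_gt0 monic_neq0.
- by move=> q q00' qK qx; apply: pmin => //; rewrite SKp.
Qed.

Lemma minpoly_powers K x d p : p \is monic -> p \is a polyOver K -> root p x ->
  size p = d.+1 ->
  (forall q, q != 0 -> q \is a polyOver K -> root q x -> (size p <= size q)%N) ->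
  spans K (@powers L x d) (x ^+ d) /\ free_over K (@powers L x d).
Proof.
move=> mp pK /rootP px sp pmin; split.
  exists (fun i : 'I_d => - p`_i) => [i|].
    by rewrite rpredN; exact: (polyOverP pK).
  move: px; rewrite horner_coef sp big_ord_recr /=.
  have -> : p`_d = 1 by rewrite -(monicP mp) lead_coefE sp.
  rewrite mul1r addrC => /eqP; rewrite addr_eq0 => /eqP ->.
  by rewrite -sumrN; apply: eq_bigr => i _; rewrite mulNr.
move=> c cK c0 i.
pose q := \poly_(j < d) (if insub j is Some k then c k else 0).
have qc (j : 'I_d) : q`_j = c j by rewrite coef_poly ltn_ord valK.
have [q0|q0] := eqVneq q 0; first by rewrite -qc q0 coef0.
have : (size p <= size q)%N.
  apply: pmin => //.
    by apply/polyOver_poly => j _; case: insub => [k|]; rewrite ?rpred0.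
  rewrite rootE (horner_coef_wide x (size_poly _ _)).
  by under eq_bigr => j _ do rewrite qc; rewrite c0.
by rewrite sp leqNgt ltnS size_poly.
Qed.

End Derivations.

Lemma quotient_ruleD (K : fieldType) (a b a' b' da db da' db' : K) :
  b != 0 -> b' != 0 ->
  ((da * b' + a * db' + (da' * b + a' * db)) * (b * b') -
     (a * b' + a' * b) * (db * b' + b * db')) / (b * b') ^+ 2 =
  (da * b - a * db) / b ^+ 2 + (da' * b' - a' * db') / b' ^+ 2.
Proof. by move=> b0 b'0; field; rewrite b0 b'0. Qed.

Lemma quotient_ruleM (K : fieldType) (a b a' b' da db da' db' : K) :
  b != 0 -> b' != 0 ->
  ((da * a' + a * da') * (b * b') - a * a' * (db * b' + b * db')) /
     (b * b') ^+ 2 =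
  (da * b - a * db) / b ^+ 2 * (a' / b') +
    a / b * ((da' * b' - a' * db') / b' ^+ 2).
Proof. by move=> b0 b'0; field; rewrite b0 b'0. Qed.

(** * Extending derivations to the fraction field *)

Section FractionDerivation.
Variable R : idomainType.
Local Notation tofrac := (@tofrac R).

Lemma fraction_div (x : {fraction R}) :
  exists a b, b != 0 /\ x = tofrac a / tofrac b.
Proof.
elim/quotW: x => r; exists \n_r, \d_r; split; first exact: denom_ratioP.
have d0 : tofrac \d_r != 0 by rewrite tofrac_eq0 denom_ratioP.
apply: (mulIf d0); rewrite divfK //; unlock tofrac.
rewrite -[LHS]FracField.pi_mul; apply/eqmodP.
rewrite /= FracField.equivfE /FracField.mulf /=.
rewrite !numden_Ratio ?oner_neq0 ?mulf_neq0 ?denom_ratioP ?oner_neq0 //.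
by rewrite !mulr1 mulrC.
Qed.

(** The quotient rule; its independence of the representation a/b follows by applying d to a b' = a'
    b. *)
Lemma fraction_derivation (d : R -> R) :
  {morph d : x y / x + y} -> (forall x y, d (x * y) = d x * y + x * d y) ->
  exists2 D : {fraction R} -> {fraction R}, derivation D &
    forall a, D (tofrac a) = tofrac (d a).
Proof.
move=> dA dM.
pose quot a b := (tofrac (d a) * tofrac b - tofrac a * tofrac (d b)) / tofrac b ^+ 2.
have quot_wd a b a' b' : b != 0 -> b' != 0 ->
    tofrac a / tofrac b = tofrac a' / tofrac b' -> quot a b = quot a' b'.
  move=> b0 b'0 /eqP; rewrite eqr_div ?tofrac_eq0 // -!tofracM tofrac_eq => /eqP E.
  apply/eqP; rewrite eqr_div ?expf_neq0 ?tofrac_eq0 //.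
  rewrite -!tofracM -!tofracXn -!tofracB -!tofracM tofrac_eq; apply/eqP.
  have dE : d a * b' + a * d b' = d a' * b + a' * d b by rewrite -!dM E.
  (* The right side involves a only through a b' and its derivative, so [dE] and [E] exchange a for
     a'. *)
  have -> : (d a * b - a * d b) * b' ^+ 2 =
      (d a * b' + a * d b') * (b * b') - (a * b') * (d b * b' + b * d b') by ring.
  by rewrite dE E; ring.
have /choice[D DP] : forall x, exists y, forall a b, b != 0 ->
    x = tofrac a / tofrac b -> y = quot a b.
  move=> x; have [a [b [b0 xE]]] := fraction_div x.
  by exists (quot a b) => a' b' b'0; rewrite xE; exact: quot_wd.
have Dq a b : b != 0 -> D (tofrac a / tofrac b) = quot a b by move=> b0; exact: DP.
have d1 : d 1 = 0.
  by apply: (addrI (d 1)); have := dM 1 1; rewrite !mulr1 mul1r addr0.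
exists D; last first.
  move=> a; rewrite -[tofrac a]divr1 -tofrac1 Dq ?oner_neq0 // /quot d1.
  by rewrite tofrac0 mulr0 subr0 tofrac1 mulr1 expr1n divr1.
split=> x y; have [a [b [b0 ->]]] := fraction_div x;
  have [a' [b' [b'0 ->]]] := fraction_div y.
- rewrite addf_div ?tofrac_eq0 // -!tofracM -tofracD !Dq ?mulf_neq0 // /quot.
  by rewrite dA !dM !tofracD !tofracM quotient_ruleD ?tofrac_eq0.
- rewrite mulf_div -!tofracM !Dq ?mulf_neq0 // /quot.
  by rewrite !dM !tofracD !tofracM quotient_ruleM ?tofrac_eq0.
Qed.
End FractionDerivation.

(** * The degrees of the coordinates over the image field *)

Lemma card_bmultinom_le n b : (#|{: 'X_{1..n < b}}| <= b ^ n)%N.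
Proof.
case: b => [|b].
  by rewrite eq_card0 // => -[m /= mb].
pose f (m : 'X_{1..n < b.+1}) : {ffun 'I_n -> 'I_b.+1} := [ffun i => inord (m i)].
have f_inj : injective f.
  move=> m1 m2 /ffunP E; apply/val_inj/mnmP => i.
  have lt (m : 'X_{1..n < b.+1}) : (m i < b.+1)%N.
    apply: leq_ltn_trans (bmdeg m); rewrite mdegE (bigD1 i) //=; exact: leq_addr.
  by have := congr1 val (E i); rewrite !ffunE /= !inordK.
by have := leq_card f f_inj; rewrite card_ffun !card_ord.
Qed.

Lemma subfield_gen_closed (L : fieldType) (A : set L) :
  GRing.divring_closed (mem (subfield_gen A)).
Proof.
split.
- by rewrite in_setE => S [[]]; rewrite in_setE.
- move=> x y; rewrite !in_setE => xA yA S [HS AS]; have [_ HB _] := HS.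
  by have := HB x y; rewrite !in_setE; apply; [exact: xA | exact: yA].
- move=> x y; rewrite !in_setE => xA yA S [HS AS]; have [_ _ HD] := HS.
  by have := HD x y; rewrite !in_setE; apply; [exact: xA | exact: yA].
Qed.

Lemma subfield_gen_mem (L : fieldType) (A : set L) a : A a -> subfield_gen A a.
Proof. by move=> Aa S [_]; apply. Qed.

Section MsizeBounds.
Variables (C : numFieldType) (n : nat).
Implicit Types p q : {mpoly C[n]}.

(** The form [msize p <= a.+1] says that the degree is at most a and covers p = 0 as well. *)
Lemma msizeM_leS p q a b : (msize p <= a.+1)%N -> (msize q <= b.+1)%N ->
  (msize (p * q) <= (a + b).+1)%N.
Proof.
have [->|p0] := eqVneq p 0; first by rewrite mul0r msize0.
have [->|q0] := eqVneq q 0; first by rewrite mulr0 msize0.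
rewrite msizeM // (mpolySpred _ p0) (mpolySpred _ q0) addnS addSn /= !ltnS => pa qb.
exact: leq_add.
Qed.

Lemma msizeXn_leS p a k : (msize p <= a.+1)%N ->
  (msize (p ^+ k) <= (a * k).+1)%N.
Proof.
move=> pa; elim: k => [|k IH]; first by rewrite expr0 msize1.
by rewrite exprS mulnS; exact: msizeM_leS.
Qed.

End MsizeBounds.

(** * The image field: algebraicity of polynomials over it, and its elements as quotients *)

Section KellerField.
Variables (C : numFieldType) (n : nat).
Local Notation P := {mpoly C[n]}.
Variable F : {lrmorphism P -> P}.
Local Notation L := {fraction P}.
Local Notation tofrac := (@tofrac P).

(** The field [image_field F] over a general coefficient field; for C = R[i] the two agree by
    conversion. *)
Definition image_subfield : set L :=
  subfield_gen (range (fun e : C => tofrac (e%:MP : P))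
                `|` range (fun i : 'I_n => tofrac (F 'X_i)))%classic.

(** C is copied into L as a subfield, since [spans] and [free_over] take coefficients inside L. *)
Lemma const_field : exists K : divringClosed L,
  forall y, y \in K <-> exists e : C, y = tofrac e%:MP.
Proof.
pose S : {pred L} := fun y => `[< exists e : C, y = tofrac e%:MP >].
have SP y : reflect (exists e : C, y = tofrac e%:MP) (y \in S) by exact: asboolP.
have [|K KE] := @divringClosed_of L S.
  split; first by apply/SP; exists 1; rewrite mpolyC1 tofrac1.
  - move=> _ _ /SP[e ->] /SP[f ->]; apply/SP.
    by exists (e - f); rewrite mpolyCB tofracB.
  - move=> _ _ /SP[e ->] /SP[f ->]; apply/SP; exists (e / f).
    have [->|f0] := eqVneq f 0; first by rewrite !(invr0, mulr0) mpolyC0 tofrac0.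
    have f0' : tofrac f%:MP != 0 by rewrite tofrac_eq0 mpolyC_eq0.
    by apply: (mulIf f0'); rewrite divfK // -tofracM -mpolyCM divfK.
by exists K => y; rewrite KE; split=> /SP.
Qed.

(* By counting: the N^(n+1) products z^k F^a with exponents less than N have
   degree O(N), hence lie in a space of dimension O(N^n). *)
Lemma poly_relation (z : P) : exists N (e : 'I_N * {ffun 'I_n -> 'I_N} -> C),
  (exists p, e p != 0) /\
  \sum_p e p *: (z ^+ p.1 * F 'X_[[multinom (p.2 i : nat) | i < n]]) = 0.
Proof.
pose a := (msize z + \sum_i msize (F 'X_i))%N.
have za : (msize z <= a.+1)%N by rewrite leqW ?leq_addr.
have Fa i : (msize (F 'X_i) <= a.+1)%N.
  by rewrite leqW // /a (bigD1 i) //= addnCA leq_addr.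
(* Each of the n + 1 factors of a product has degree at most N a, so the product has degree below b
   = N s. There are at most N^n s^n monomials of degree below b, fewer than the N^(n+1) products
   because s^n < N. *)
pose s := (a * n.+1).+1; pose N := (s ^ n).+1; pose b := (N * s)%N.
have [K KP] := const_field.
pose I := ('I_N * {ffun 'I_n -> 'I_N})%type.
pose v (p : I) : P := z ^+ p.1 * F 'X_[[multinom (p.2 i : nat) | i < n]].
have vb p : (msize (v p) <= b)%N.
  have -> : b = (N * a * n.+1 + s ^ n).+1 by rewrite /b /s mulnS addnC mulnA /N addnS.
  apply: (@leq_trans (N * a * n.+1).+1); last by rewrite ltnS leq_addr.
  have le k : (k < N)%N -> (a * k <= N * a)%N.
    by move=> /ltnW kN; rewrite mulnC leq_mul2r kN orbT.
  rewrite mulnS; apply: msizeM_leS.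
    by apply: leq_trans (msizeXn_leS _ za) _; rewrite ltnS le.
  rewrite mpolyXE_id rmorph_prod /=.
  have -> : (N * a * n = \sum_(i < n) N * a)%N by rewrite sum_nat_const card_ord mulnC.
  elim/big_ind2: _ => [|p1 x1 p2 x2|i _]; first by rewrite msize1.
    exact: msizeM_leS.
  rewrite rmorphXn /=; apply: leq_trans (msizeXn_leS _ (Fa i)) _.
  by rewrite ltnS mnmE le.
have : ~ free_over K (fun p : I => tofrac (v p)).
  apply: (@dependent_of_card L K _ _ (fun m : 'X_{1..n < b} => tofrac 'X_[m])).
    move=> p; exists (fun m : 'X_{1..n < b} => tofrac ((v p)@_m)%:MP).
      by move=> m; apply/KP; exists (v p)@_m.
    rewrite {1}(mpolywE (vb p)) rmorph_sum /=; apply: eq_bigr => m _.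
    by rewrite -mul_mpolyC tofracM.
  apply: leq_ltn_trans (card_bmultinom_le _ _) _.
  rewrite card_prod card_ffun !card_ord /b expnMn mulnC ltn_pmul2r ?expn_gt0 //.
move=> /not_free_over[c [cK c0 [p cp]]].
have /choice[e eE] : forall p, exists e, c p = tofrac e%:MP by move=> q; exact/KP.
exists N, e; split.
  by exists p; move: cp; rewrite eE tofrac_eq0 mpolyC_eq0.
apply/eqP; rewrite -tofrac_eq0 rmorph_sum /=; apply/eqP; rewrite -[RHS]c0.
by apply: eq_bigr => q _; rewrite eE -mul_mpolyC tofracM.
Qed.

Lemma image_subfield_lrmorph p : image_subfield (tofrac (F p)).
Proof.
have [K KE] := divringClosed_of (@subfield_gen_closed L
  (range (fun e : C => tofrac (e%:MP : P)) `|`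
   range (fun i : 'I_n => tofrac (F 'X_i)))%classic).
have KP y : image_subfield y <-> y \in K.
  by rewrite KE in_setE.
apply/KP; elim/mpoly_ring_ind: p => [e|i|p q pK qK|p q pK qK].
- by apply/KP; apply: subfield_gen_mem; left; exists e; rewrite ?lrmorph_mpolyC.
- by apply/KP; apply: subfield_gen_mem; right; exists i.
- by rewrite rmorphD tofracD rpredD.
- by rewrite rmorphM tofracM rpredM.
Qed.

Variable c : C.
Hypotheses (c0 : c != 0) (detJ : \det (jacobian_mx F) = c%:MP).

(** The quotients F(u)/F(v) with v nonzero contain the generators and form a subfield, as
    injectivity of F keeps the denominators nonzero. *)
Lemma image_subfield_quot y : image_subfield y ->
  exists u v, v != 0 /\ y = tofrac (F u) / tofrac (F v).
Proof.
have F0 v : v != 0 -> tofrac (F v) != 0.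
  by move=> v0; rewrite tofrac_eq0; apply: contraNneq v0 => /(keller_eq0 c0 detJ)->.
move: y; apply: (smallest_sub (C := fun S => GRing.divring_closed (mem S))
  (X := [set y | exists u v, v != 0 /\ y = tofrac (F u) / tofrac (F v)]%classic)).
  split.
  - by rewrite in_setE; exists 1, 1; rewrite oner_neq0 rmorph1 tofrac1 divr1.
  - move=> x y; rewrite !in_setE => -[u [v [v0 ->]]] [u' [v' [v'0 ->]]].
    exists (u * v' - u' * v), (v * v'); rewrite mulf_neq0 //; split=> //.
    rewrite -mulNr addf_div ?F0 // -!tofracM -tofracN -!tofracM -tofracD -!rmorphM.
    by rewrite -rmorphN -rmorphM -rmorphD mulNr.
  - move=> x y; rewrite !in_setE => -[u [v [v0 ->]]] [u' [v' [v'0 ->]]].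
    have [->|u'0] := eqVneq u' 0.
      exists 0, 1; rewrite oner_neq0; split=> //.
      by rewrite !rmorph0 mul0r invr0 mulr0 mul0r.
    exists (u * v'), (v * u'); rewrite mulf_neq0 //; split=> //.
    by rewrite invf_div mulf_div -!tofracM -!rmorphM.
move=> y [[e _ <-]|[i _ <-]].
- by exists e%:MP, 1; rewrite oner_neq0 rmorph1 tofrac1 divr1 lrmorph_mpolyC.
- by exists 'X_i, 1; rewrite oner_neq0 rmorph1 tofrac1 divr1.
Qed.

(** Collecting [poly_relation] by powers of z gives coefficients F(r_k). Some r_k is nonzero, and
    injectivity of F keeps its image nonzero. *)
Lemma keller_algebraic (K : divringClosed L) (z : P) : image_subfield =i K ->
  exists q, [/\ q != 0, q \is a polyOver K & root q (tofrac z)].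
Proof.
move=> SK; have [N [e [[[k0 a0] e0] E]]] := poly_relation z.
pose m (a : {ffun 'I_n -> 'I_N}) : 'X_{1..n} := [multinom (a i : nat) | i < n].
have m_inj : injective m.
  move=> a b /mnmP E'; apply/ffunP => i; apply: val_inj.
  by have := E' i; rewrite !mnmE.
pose r (k : 'I_N) : P := \sum_a e (k, a) *: 'X_[m a].
pose q : {poly L} := \poly_(k < N) (if insub k is Some k then tofrac (F (r k)) else 0).
have qc (k : 'I_N) : q`_k = tofrac (F (r k)) by rewrite coef_poly ltn_ord valK.
exists q; split.
- apply: contra_neqN e0 => /eqP q0 {E}.
  have /eqP : q`_k0 = 0 by rewrite q0 coef0.
  rewrite qc tofrac_eq0 => /eqP /(keller_eq0 c0 detJ) /(congr1 (mcoeff (m a0))).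
  rewrite mcoeff0 raddf_sum (bigD1 a0) //= mcoeffZ mcoeffX eqxx mulr1.
  rewrite big1 ?addr0 // => a aa0.
  by rewrite mcoeffZ mcoeffX (inj_eq m_inj) (negPf aa0) mulr0.
- apply/polyOver_poly => k _; case: insub => [k'|]; last exact: rpred0.
  by rewrite -SK in_setE; exact: image_subfield_lrmorph.
- rewrite rootE (horner_coef_wide _ (size_poly _ _)).
  under eq_bigr => k _ do rewrite qc -tofracXn -tofracM.
  rewrite -rmorph_sum /= tofrac_eq0; apply/eqP; rewrite -[RHS]E.
  transitivity (\sum_k \sum_a e (k, a) *: (z ^+ k * F 'X_[m a])).
    apply: eq_bigr => k _; rewrite rmorph_sum /= mulr_suml; apply: eq_bigr => a _.
    by rewrite linearZ /= -scalerAl mulrC.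
  by rewrite pair_big; apply: eq_bigr => -[k a].
Qed.

End KellerField.

Lemma rpred_det (R : comNzRingType) (S : subringClosed R) n (A : 'M[R]_n) :
  (forall i j, A i j \in S) -> \det A \in S.
Proof.
by move=> AS; apply: rpred_sum => s _; rewrite rpredMsign rpred_prod.
Qed.

(** * All coordinates have degree one *)

Section KellerDegrees.
Variables (C : numFieldType) (n : nat).
Local Notation P := {mpoly C[n]}.
Local Notation L := {fraction P}.
Local Notation tofrac := (@tofrac P).

Lemma tofrac_natr_neq0 k : k.+1%:R != 0 :> L.
Proof. by rewrite -tofrac1 -tofracMn tofrac_eq0 -mpolyC_nat mpolyC_eq0 pnatr_eq0. Qed.

Section PartialConstants.
Variables (i : 'I_n) (E : divringClosed L).
Hypothesis constE : forall e : C, tofrac e%:MP \in E.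
Hypothesis varE : forall j, j != i -> tofrac 'X_j \in E.

Lemma partial_const_poly (p : P) : p^`M(i) = 0 -> tofrac p \in E.
Proof.
move=> dp; rewrite [p]mpolyE rmorph_sum rpred_sum // => m _ /=.
have [->|pm0] := eqVneq p@_m 0; first by rewrite scale0r tofrac0 rpred0.
have mi : m i = 0%N.
  apply/eqP; apply: contraNT pm0 => mi.
  have := congr1 (mcoeff (m - U_(i))%MM) dp.
  rewrite mcoeff_mderiv mcoeff0 submK; last by rewrite lep1mP.
  by move/eqP; rewrite mulrn_eq0.
rewrite -mul_mpolyC tofracM rpredM // mpolyXE_id rmorph_prod rpred_prod // => j _.
rewrite /= tofracXn; have [->|ji] := eqVneq j i; first by rewrite mi rpred1.
by rewrite rpredX // varE.
Qed.

(** The equation says that a/b has derivative zero. Unless b has derivative zero, a/b equals the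
    quotient of the two derivatives, which satisfies the same equation with a smaller denominator;
    lowest terms are thus avoided. *)
Lemma partial_const_quot (a b : P) : b != 0 -> a^`M(i) * b = a * b^`M(i) ->
  tofrac a / tofrac b \in E.
Proof.
have [m] := ubnP (msize b); elim: m a b => // m IH a b lt b0 ab.
have [db|db] := eqVneq b^`M(i) 0.
  have da : a^`M(i) = 0.
    by apply: (mulIf b0); rewrite mul0r ab db mulr0.
  by rewrite rpredM ?rpredV // partial_const_poly.
have -> : tofrac a / tofrac b = tofrac a^`M(i) / tofrac b^`M(i).
  by apply/eqP; rewrite eqr_div ?tofrac_eq0 // -!tofracM ab.
apply: IH => //.
  by rewrite -ltnS (leq_trans _ lt) // ltnS msize_mderiv_lt.
have := congr1 (mderiv i) ab; rewrite !mderivM [in RHS]addrC => /addIr dab.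
by apply: (mulIf b0); rewrite mulrAC dab mulrAC -ab mulrAC.
Qed.

End PartialConstants.

Variable F : {lrmorphism P -> P}.
Variable c : C.
Hypotheses (c0 : c != 0) (detJ : \det (jacobian_mx F) = c%:MP).
Local Notation N := (inv_jacobian_mx F c).
Local Notation J := (jacobian_mx F).

(* Cramer's rule: d F_j / d x_i is, up to a constant, the minor of the inverse
   Jacobian matrix (d x_l / d F_k) avoiding the row of x_i. *)
Lemma mderiv_image_mem i j (E : divringClosed L) :
  (forall e : C, tofrac e%:MP \in E) ->
  (forall l k, l != i -> tofrac (N l k) \in E) ->
  tofrac (F 'X_j)^`M(i) \in E.
Proof.
move=> constE NE; have JN := mul_jacobian_inv c0 detJ.
have detN : \det N = c^-1%:MP.
  have cP0 : c%:MP != 0 :> P by rewrite mpolyC_eq0.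
  apply: (mulfI cP0); rewrite -[in LHS]detJ -det_mulmx JN det1.
  by rewrite -mpolyCM mulfV // mpolyC1.
have adjE : J = c%:MP *: \adj N.
  rewrite -[RHS]mulmx1 -(mulmx1C JN) mulmxA -scalemxAl mul_adj_mx detN.
  by rewrite scale_scalar_mx -mpolyCM mulfV // mpolyC1 mul1mx.
have -> : (F 'X_j)^`M(i) = J j i by rewrite mxE.
rewrite adjE !mxE tofracM rpredM // /cofactor tofracM rpredM //.
  by rewrite rmorphXn rmorphN rmorph1 rpredX // rpredN rpred1.
rewrite -det_map_mx; apply: rpred_det => k l; rewrite 3!mxE.
by apply: NE; rewrite eq_sym neq_lift.
Qed.

Lemma keller_degree_one :
  (forall u v : 'I_n, u != v ->
     coprime (minpoly_degree (image_subfield F) (tofrac 'X_u))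
             (minpoly_degree (image_subfield F) (tofrac 'X_v))) ->
  forall i, image_subfield F (tofrac 'X_i).
Proof.
move=> cop i.
have [K KE] := divringClosed_of (@subfield_gen_closed L
  (range (fun e : C => tofrac (e%:MP : P)) `|`
   range (fun i : 'I_n => tofrac (F 'X_i)))%classic).
have SK : image_subfield F =i K by move=> y; rewrite KE.
have KP y : image_subfield F y <-> y \in K by rewrite -SK in_setE.
pose x l := tofrac ('X_l : P); pose d l := minpoly_degree (image_subfield F) (x l).
have FK p : tofrac (F p) \in K by apply/KP; exact: image_subfield_lrmorph.
have constK (e : C) : tofrac e%:MP \in K by rewrite -(lrmorph_mpolyC F).
have pP l := minpoly_overP SK (keller_algebraic c0 detJ 'X_l SK).
have xd l : spans K (@powers L (x l) (d l)) (x l ^+ d l) /\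
    free_over K (@powers L (x l) (d l)).
  by have [p [mp pK px sp pmin]] := pP l; exact: minpoly_powers mp pK px sp pmin.
have [E [KsE xE fE]] :=
  coprime_adjoin (fun l => (xd l).1) (fun l => (xd l).2) cop i.
have constE (e : C) : tofrac e%:MP \in E by exact: KsE.
have NE l k : l != i -> tofrac (N l k) \in E.
  move=> li; have [D dD DE] := fraction_derivation (@image_derivD _ _ F c k)
    (@image_derivM _ _ F c k).
  have -> : N l k = image_deriv F c k 'X_l.
    rewrite /image_deriv (bigD1 l) //= big1 ?addr0 => [|j jl].
      by rewrite mderivXU eqxx mulr1.
    by rewrite mderivXU eq_sym (negPf jl) mulr0.
  rewrite -DE; have [p [mp pK px _ pmin]] := pP l.
  apply: (derivation_algebraic tofrac_natr_neq0 dD KsE _ (xE l li) pK px _ pmin).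
    (* The derivation d/dF_k preserves K because it sends F(p) to F of a partial derivative of p. *)
    move=> y /KP; move: y; suff H y : image_subfield F y -> y \in K /\ D y \in K.
      by move=> y /H[_ /KsE].
    apply: derivation_subfield => // _ [[e _ <-]|[j _ <-]].
      split=> //; rewrite DE -(lrmorph_mpolyC F) (image_deriv_lrmorph c0 detJ).
      exact: FK.
    by split=> //; rewrite DE (image_deriv_lrmorph c0 detJ).
  exact: root_size_gt1 (monic_neq0 mp) px.
have [D dD DE] :=
  @fraction_derivation P (mderiv i) (@mderivD _ _ i) (@mderivM _ _ i).
have DK y : y \in K -> D y \in E.
  move=> /KP; move: y; suff H y : image_subfield F y -> y \in E /\ D y \in E.
    by move=> y /H[].
  apply: derivation_subfield => // _ [[e _ <-]|[j _ <-]].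
    by split=> //; rewrite DE mderivC tofrac0 rpred0.
  by split; rewrite ?DE; [apply: KsE | exact: mderiv_image_mem].
have Dx : D (x i) = 1.
  by rewrite DE mderivXU eqxx tofrac1.
have [p [mp pK px sp _]] := pP i.
have := root_size_gt1 (monic_neq0 mp) px; rewrite sp ltnS -/(x i) -/(d i).
case dE : (d i) => [//|m] _; rewrite -/(x i) -/(d i) dE in sp.
rewrite dE in fE.
have D0 := derivation_trace tofrac_natr_neq0 dD KsE DK Dx pK mp px sp fE.
have hK : p`_m / m.+1%:R \in K by rewrite rpredM ?rpredV ?rpred_nat // (polyOverP pK).
have xiE : x i \in E.
  rewrite -[x i](addrK (p`_m / m.+1%:R)) rpredB ?(KsE _ hK) //.
  have [a [b [b0 yE]]] := fraction_div (x i + p`_m / m.+1%:R).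
  rewrite yE; apply: (partial_const_quot constE xE) => //.
  apply/eqP; rewrite -tofrac_eq !tofracM -!DE; apply/eqP.
  have tb : tofrac b != 0 by rewrite tofrac_eq0.
  have -> : tofrac a = (x i + p`_m / m.+1%:R) * tofrac b by rewrite yE divfK.
  by rewrite dD.2 D0 mul0r add0r mulrAC.
case: m dE sp fE {D0 hK} => [|m] dE sp fE.
  move: px => /rootP; rewrite horner_coef sp !big_ord_recl big_ord0 /= addr0.
  have -> : p`_1 = 1 by rewrite -(monicP mp) lead_coefE sp.
  rewrite expr0 mulr1 mul1r expr1 addrC => /eqP; rewrite addr_eq0 => /eqP xE'.
  suff : x i \in K by move/KP.
  by rewrite (xE' : x i = - p`_0) rpredN; exact: (polyOverP pK).
(* If d_i is at least 2, the coefficients x_i, -1, 0, ... in E give a nontrivial relation among the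
   powers 1, x_i, ... of x_i, against their freeness. *)
pose e (k : 'I_m.+2) := if val k == 0%N then x i else if val k == 1%N then -1 else 0.
have := fE e _ _ (lift ord0 ord0); rewrite /e /= => H.
suff /eqP : (-1 : L) = 0 by rewrite oppr_eq0 oner_eq0.
apply: H => [k|].
  by case: ifP => // _; case: ifP => _; rewrite ?rpredN ?rpred1 ?rpred0.
rewrite !big_ord_recl /= big1 => [|k _]; last by rewrite mul0r.
by rewrite /powers expr0 expr1 mulr1 mulN1r addr0 subrr.
Qed.

End KellerDegrees.

Theorem theorem4p8 (R : realType) (n : nat) (hn : (2 <= n)%N)
    (F : {lrmorphism {mpoly R[i][n]} -> {mpoly R[i][n]}})
    (hJ : invertible_jacobian F)
    (hd : forall u v : 'I_n, u != v ->
       gcdn (var_degree F u) (var_degree F v) = 1%N) :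
  bijective F.
Proof.
have [c c0 detJ] := hJ.
apply: (keller_birational_bijective c0 detJ) => i.
have cop u v : u != v ->
    coprime (minpoly_degree (image_subfield F) (tofrac 'X_u))
            (minpoly_degree (image_subfield F) (tofrac 'X_v)).
  by move=> uv; apply/eqP; exact: hd.
have [u [v [v0 E]]] := image_subfield_quot c0 detJ (keller_degree_one c0 detJ cop i).
exists u, v; split=> //; apply/eqP; rewrite -tofrac_eq tofracM E mulrC divfK //.
by rewrite tofrac_eq0; apply: contraNneq v0 => /(keller_eq0 c0 detJ)->.
Qed.
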